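(* Let $X$ be an infinite-dimensional Banach space such that all spreading models of normalized basic sequences in $X$ are equivalent. Then: (a) If all the spreading models are uniformly equivalent, i.e. if there exists $D\in\mathbb{R}$ such that the spreading models of all normalized basic sequences in $X$ are $D$-equivalent, then all spreading models of $X$ are equivalent to the unit vector basis of $\ell_p$ for some $1\le p<\infty$ or of $c_0$. (b) Let $(z_i)$ be a normalized basic sequence which dominates a (hence every) spreading model of $X$. Then there exists $C<\infty$ such that $(z_i)$ $C$-dominates the spreading model of every normalized basic sequence $(x_i)$ in $X$ which has a spreading model. (c) If $p$ belongs to the Krivine set of the spreading model $(\tilde x_i)$ of some normalized basic sequence $(x_i)$ of $X$, then $(\tilde x_i)$ dominates the unit vector basis of $\ell_p$. (d) If $1$ belongs to the Krivine set of some spreading model in $X$, then all spreading models of $X$ are equivalent to the unit vector basis of $\ell_1$.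
   Context: Banach spaces are real. A seminormalized sequence $(x_i)$ in a Banach space has (generates) the spreading model $(\tilde x_i)$, where $(\tilde x_i)$ is a basic sequence in some Banach space, if for some sequence $\varepsilon_n\searrow 0$ one has, for all $n\in\mathbb{N}$, all $(a_i)_{i=1}^n\in[-1,1]^n$ and all integers $n\le k_1<\dots<k_n$, $$\left|\Big\|\sum_{i=1}^n a_i x_{k_i}\Big\|-\Big\|\sum_{i=1}^n a_i\tilde x_i\Big\|\right|<\varepsilon_n .$$ The spreading models of (or in) $X$ are those generated by normalized basic sequences in $X$. For basic sequences, $(x_i)$ $C$-dominates $(y_i)$ if $C\|\sum a_ix_i\|\ge\|\sum a_iy_i\|$ for all finitely supported scalar sequences $(a_i)$, and dominates it if this holds for some $C$. Two basic sequences are equivalent if each dominates the other. The Krivine set of a basic sequence $(x_i)$ that is isometrically equivalent to all its subsequences (as every spreading model is) is the set of all $p\in[1,\infty]$ such that for all $\varepsilon>0$ and $n\in\mathbb{N}$ there exist $m\in\mathbb{N}$ and $(\lambda_k)_{k=1}^m\subset\mathbb{R}$ such that for all $(a_i)_{i=1}^n\subset\mathbb{R}$ $$\frac1{1+\varepsilon}\|(a_i)_{i=1}^n\|_p\le\Big\|\sum_{i=1}^na_iy_i\Big\|\le(1+\varepsilon)\|(a_i)_{i=1}^n\|_p,\qquad y_i=\sum_{k=1}^m\lambda_kx_{(i-1)m+k}\ (i=1,\dots,n),$$ where $\|\cdot\|_p$ is the $\ell_p$ norm. (For $p=\infty$ the unit vector basis of $\ell_p$ means that of $c_0$.) *)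

(* Defs.v *)
From HB Require Import structures.
From mathcomp Require Import all_boot all_order all_algebra.
From mathcomp Require Import all_classical all_reals all_analysis.
From mathcomp Require Import ess_sup_inf hoelder.

Set Implicit Arguments.
Unset Strict Implicit.
Unset Printing Implicit Defensive.

Import Order.TTheory GRing.Theory Num.Theory.
Import numFieldNormedType.Exports.

Local Open Scope classical_set_scope.
Local Open Scope ring_scope.

(* l_p (1 <= p <= +oo) is the library's space of p-integrable functions for the
   counting measure on nat; as no nonempty set is negligible, the L_p seminorm
   is a norm. *)
Definition ellp (R : realType) (p : \bar R) (p1 : (1 <= p)%E) : Type :=
  LfunType (@counting nat R) p1.

Section ellp_norm.
Context {R : realType} {p : \bar R} (p1 : (1 <= p)%E).

HB.instance Definition _ := GRing.Lmodule.on (ellp p1).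

Definition ellp_fun (f : ellp p1) : nat -> R := (f : LfunType _ p1).

Definition ellp_norm (f : ellp p1) : R :=
  fine ('N[@counting nat R]_p [EFin \o ellp_fun f])%E.

Let ellp_norm_fineK (f : ellp p1) :
  (ellp_norm f)%:E = ('N[@counting nat R]_p [EFin \o ellp_fun f])%E.
Proof. exact: finite_norm_fine. Qed.

Let ler_ellp_normD (f g : ellp p1) :
  ellp_norm (f + g) <= ellp_norm f + ellp_norm g.
Proof. exact: ler_LnormD. Qed.

Let ellp_normZ (l : R) (f : ellp p1) :
  ellp_norm (l *: f) = `|l| * ellp_norm f.
Proof.
by apply: EFin_inj; rewrite EFinM !ellp_norm_fineK -(LnormZ (f : LfunType _ p1)).
Qed.

Lemma counting_ae (P : nat -> Prop) :
  {ae (@counting nat R), forall n, P n} -> forall n, P n.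
Proof.
move=> [A [mA A0 PA]] n; apply: contrapT => nPn.
have An : A n by exact: PA.
have : (counting [set n] <= counting A :> \bar R)%E.
  by apply: le_measure; rewrite ?inE// => _ ->.
rewrite A0 /counting asboolT// fset_set1 finmap.cardfs1.
by rewrite lee_fin ler10.
Qed.

Let ellp_norm_eq0 (f : ellp p1) : ellp_norm f = 0 -> f = 0.
Proof.
move=> /(@fine_Lnormr_eq0 _ _ _ _ _ p1) f0; apply/LfuneqP => n.
by have /(_ n I) := counting_ae f0.
Qed.

HB.instance Definition _ := Lmodule_isNormed.Build R (ellp p1)
  ler_ellp_normD ellp_normZ ellp_norm_eq0.

Let delta_Lfun (i : nat) :
  (\1_[set i] : nat -> R) \in Lfun (@counting nat R) p.
Proof.
rewrite inE; apply/andP; split; rewrite inE//=.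
rewrite /finite_norm; move: p1; case: p => [r|_|//]; last first.
  rewrite unlock /Lnorm; case: ifPn => // _.
  apply: (@le_lt_trans _ _ 1%E); last exact: ltry.
  apply/ess_supP/nearW => n /=.
  by rewrite lee_fin indicE; case: (_ \in _); rewrite ?normr1 ?normr0.
rewrite lee_fin => r1; have r0 : 0 < r by exact: lt_le_trans r1.
rewrite Lnorm_counting// (nneseries_split 0 i.+1); last first.
  by move=> k _; exact: poweR_ge0.
rewrite eseries0 ?adde0.
  apply: poweR_lty; rewrite ltey_eq; apply/orP; left.
  by apply/sum_fin_numP => k _ _; rewrite /= -poweR_EFin.
move=> k ik _ /=; rewrite indicE memNset ?normr0 ?poweR_EFin ?powR0 ?gt_eqF//.
by move=> /= ki; move: ik; rewrite ki ltnn.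
Qed.

(* the unit vector basis of l_p if p < +oo, and of c_0 if p = +oo (c_0 carries
   the norm of l_oo) *)
Definition unit_vector_basis (i : nat) : ellp p1 := Lfun_Sub p1 (delta_Lfun i).

End ellp_norm.

Section ellp_norm_explicit.
Context {R : realType}.

Let ellp_funE (p : \bar R) (p1 : (1 <= p)%E) n (a : 'I_n -> R) k :
  ellp_fun (\sum_(i < n) a i *: unit_vector_basis p1 i) k =
  if insub k is Some i then a i else 0.
Proof.
transitivity (\sum_(i < n) a i * (k == i)%:R).
  pose ev (f : ellp p1) : R := ellp_fun f k.
  have ev_sum : ev (\sum_(i < n) a i *: unit_vector_basis p1 i) =
                \sum_(i < n) ev (a i *: unit_vector_basis p1 i).
    by apply: (big_morph ev).
  rewrite [LHS]ev_sum; apply: eq_bigr => i _.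
  rewrite -[LHS]/(a i * \1_[set val i] k) indicE; congr (_ * _%:R).
  by congr nat_of_bool; apply/idP/eqP => [/set_mem//|->]; rewrite inE.
case: insubP => [i _ <-|kn].
  rewrite (bigD1 i)//= eqxx mulr1 big1 ?addr0// => j /negbTE ji.
  by rewrite (inj_eq val_inj) eq_sym ji mulr0.
rewrite big1// => i _; case: eqP => [ki|_]; last by rewrite mulr0.
by rewrite ki ltn_ord in kn.
Qed.

Lemma ellp_normE (r : R) (r1 : (1 <= r%:E)%E) n (a : 'I_n -> R) :
  `|\sum_(i < n) a i *: unit_vector_basis r1 i| =
  (\sum_(i < n) `|a i| `^ r) `^ r^-1.
Proof.
have r0 : 0 < r by have := r1; rewrite lee_fin; exact: lt_le_trans.
rewrite -[LHS]/(ellp_norm _) /ellp_norm Lnorm_counting//.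
rewrite (nneseries_split 0 n); last by move=> k _; exact: poweR_ge0.
rewrite eseries0 ?adde0; last first.
  move=> k; rewrite add0n => nk _; rewrite /= ellp_funE insubF ?ltnNge ?nk//.
  by rewrite normr0 powR0// gt_eqF.
rewrite add0n big_mkord [X in (X `^ _)%E](_ : _ = (\sum_(i < n) `|a i| `^ r)%:E).
  by rewrite poweR_EFin.
rewrite -sumEFin; apply: eq_bigr => i _.
by rewrite /= ellp_funE valK.
Qed.

Lemma ellp_norm_ooE (p1 : (1 <= +oo :> \bar R)%E) n (a : 'I_n -> R) :
  `|\sum_(i < n) a i *: unit_vector_basis p1 i| =
  \big[Num.max/0]_(i < n) `|a i|.
Proof.
rewrite -[LHS]/(ellp_norm _) /ellp_norm unlock /Lnorm.
have cT : (0 < (@counting nat R) [set: nat])%E.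
  apply: (@lt_le_trans _ _ (counting [set 0%N])).
    by rewrite /counting asboolT// fset_set1 finmap.cardfs1 lte_fin ltr01.
  by apply: le_measure; rewrite ?inE.
rewrite cT; apply/EFin_inj; set f := ellp_fun _; set M := \big[_/_]_(_ < _) _.
have M0 : 0 <= M by apply: bigmax_ge_id.
have fM k : `|f k| <= M.
  rewrite /f ellp_funE; case: insubP => [i _ _|_]; last by rewrite normr0.
  exact: (le_bigmax _ (fun i => `|a i|)).
suff -> : ess_sup (@counting nat R) (abse \o (EFin \o f)) = M%:E by [].
apply/eqP; rewrite eq_le; apply/andP; split.
  by apply/ess_supP/nearW => k /=; rewrite lee_fin.
have /= sup_ge := counting_ae (ess_sup_ge (@counting nat R) (abse \o (EFin \o f))).
set S := ess_sup _ _ in sup_ge *.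
have S0 : (0 <= S)%E by apply: le_trans (sup_ge 0%N); rewrite lee_fin.
rewrite /M; elim/big_ind: _ => // [x y xS yS|i _].
  by rewrite /Num.max; case: ifP.
by have := sup_ge i; rewrite /f ellp_funE valK.
Qed.

End ellp_norm_explicit.

Section sequences_in_normed_spaces.
Context {R : realType}.
Implicit Types (E F X : completeNormedModType R) (V W : normedModType R).

Definition infinite_dimensional V : Prop :=
  forall n (v : 'I_n -> V), exists u,
    forall c : 'I_n -> R, u <> \sum_(i < n) c i *: v i.

Definition finite_span V (x : V ^nat) : set V :=
  [set u | exists n (c : 'I_n -> R), u = \sum_(i < n) c i *: x i].

(* a Schauder basis of its closed linear span *)
Definition basic_sequence E (x : E ^nat) : Prop :=
  forall u, closure (finite_span x) u ->
    exists! c : R ^nat, series (fun i => c i *: x i) @ \oo --> u.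

Definition normalized V (x : V ^nat) : Prop := forall i, `|x i| = 1.

Definition seminormalized V (x : V ^nat) : Prop :=
  exists m M : R, 0 < m /\ forall i, m <= `|x i| <= M.

Definition normalized_basic E (x : E ^nat) : Prop :=
  normalized x /\ basic_sequence x.

(* Sequences are indexed from 0 here, so x i is the term of index i.+1 of the
   usual 1-based convention; this is where the .+1 in n <= (k i).+1 comes from.
   As k is increasing, requiring it for every i amounts to requiring it for the
   first one. *)
Definition has_spreading_model E F (x : E ^nat) (xt : F ^nat) : Prop :=
  [/\ seminormalized x, basic_sequence xt &
    exists eps : R ^nat,
      [/\ nonincreasing_seq eps, eps @ \oo --> 0 &
        forall n, (0 < n)%N ->
        forall (a : 'I_n -> R) (k : 'I_n -> nat),
          (forall i, -1 <= a i <= 1) ->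
          (forall i, (n <= (k i).+1)%N) ->
          {homo k : i j / (i < j)%N} ->
          `| `|\sum_(i < n) a i *: x (k i)| - `|\sum_(i < n) a i *: xt i| |
            < eps n]].

Definition spreading_model_in X F (xt : F ^nat) : Prop :=
  exists x : X ^nat, normalized_basic x /\ has_spreading_model x xt.

Definition dominates_with (C : R) V W (x : V ^nat) (y : W ^nat) : Prop :=
  forall n (a : 'I_n -> R),
    `|\sum_(i < n) a i *: y i| <= C * `|\sum_(i < n) a i *: x i|.

Definition dominates V W (x : V ^nat) (y : W ^nat) : Prop :=
  exists C : R, dominates_with C x y.

Definition equivalent V W (x : V ^nat) (y : W ^nat) : Prop :=
  dominates x y /\ dominates y x.

Definition equivalent_with (D : R) V W (x : V ^nat) (y : W ^nat) : Prop :=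
  dominates_with D x y /\ dominates_with D y x.

Definition block_sequence V (x : V ^nat) m (lambda : 'I_m -> R) : V ^nat :=
  fun i => \sum_(k < m) lambda k *: x (i * m + k)%N.

Definition krivine_set E (x : E ^nat) : set (\bar R) :=
  [set p | exists p1 : (1 <= p)%E,
    forall (eps : R) (n : nat), 0 < eps ->
    exists m (lambda : 'I_m -> R), forall a : 'I_n -> R,
      let lp_norm := `|\sum_(i < n) a i *: unit_vector_basis p1 i| in
      (1 + eps)^-1 * lp_norm
        <= `|\sum_(i < n) a i *: block_sequence x lambda i|
        <= (1 + eps) * lp_norm].

End sequences_in_normed_spaces.
Arguments spreading_model_in {R} X {F} xt.

(* Main.v *)
From HB Require Import structures.
Require Import Defs.
From mathcomp Require Import all_boot all_order all_algebra.
From mathcomp Require Import all_classical all_reals all_analysis.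
From mathcomp Require Import ring lra.

Set Implicit Arguments.
Unset Strict Implicit.
Unset Printing Implicit Defensive.

Import Order.TTheory GRing.Theory Num.Theory.
Import numFieldNormedType.Exports.

Local Open Scope classical_set_scope.
Local Open Scope ring_scope.

(** Spreading models are read off ultrafilters.  For an ultrafilter G on X that
    contains the unit sphere, the iterated limit of |a_1 y_1 + ... + a_n y_n|, as
    y_n, ..., y_1 run along G one after the other, is a seminorm in a, written
    [iter_norm G a 0].  A normalized sequence with a spreading model yields such
    an ultrafilter, with the norm of the spreading model as its iterated limits
    ([spreading_model_ultra]).  Conversely, call G null if f 0 is at most the
    limit of f along G for every convex Lipschitz f; this is how weak nullness
    will be used, with no functionals involved.  Iterated limits along a null
    ultrafilter do not increase when coordinates are suppressed, and a sequence
    of vectors chosen generically for G is basic and has the iterated limit norm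
    as its spreading model ([realize_ultra]).  Blocks, differences and infinite
    sums of sequences become operations on ultrafilters, and their norms are
    compared in the convex order: G is above H when the limits of all convex
    Lipschitz functions along G are at least those along H.

    Suppose now that all spreading models are equivalent.  Differences of generic
    vectors form a null ultrafilter, so every spreading model is unconditional.
    If one of them has no small convex combinations of its basis, then by
    unconditionality it is the basis of l_1, and so are all others.  Otherwise
    small convex combinations and Jensen's inequality make every generating
    ultrafilter null ([l1_or_null]).  In the first case all four claims are
    immediate; in the second they are proved as follows.

    (b) If z dominated the spreading models of sequences x^n only with constants
    4^n, consider the ultrafilter of the sums of 2^-n x^n.  It lies above the
    2^-n multiple of each x^n in the convex order, so its spreading model
    dominates that of x^n with constant of order 2^n; but it is equivalent to the
    spreading models that z dominates, a contradiction for large n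
    ([spreading_models_uniformly_dominated]).

    (c) Blocks that witness p in the Krivine set generate spreading models which
    are close to l_p on their first n vectors; by (b) they are dominated by the
    given spreading model uniformly in n ([krivine_dominates]).  (d) is the case
    p = 1, as l_1 dominates everything.

    (a) Applied to blocks, uniform equivalence says that the norm of a tensor
    product of coefficient vectors is, up to a constant, the product of the
    norms.  The norm of the sum of n basis vectors is then of the order n^a for
    some a, and comparing tensor powers of a vector with their dyadic level sets
    gives the l_p norm with p = 1/a, or the c_0 norm when a = 0
    ([tensor_norm_lp]); Krivine's theorem is bypassed. *)
(** * Ultrafilters and limits along them *)

(** Ultrafilters are bundled so that the operations of the ultrafilter monad
    apply; its bind turns iterated limits into limits. *)
Record ultra (T : Type) := Ultra {
  umem :> set T -> Prop ;
  umem_proper : ProperFilter umem ;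
  umemVC : forall A, umem A \/ umem (~` A) }.
#[global] Existing Instance umem_proper.

Section ultrafilters.
Context {R : realType}.

Lemma ultra_ex T (G : ultra T) A : G A -> exists y, A y.
Proof. exact: filter_ex. Qed.

Lemma ultra_ex2 T (G : ultra T) A B : G A -> G B -> exists y, A y /\ B y.
Proof. by move=> GA GB; have [y] := filter_ex (filterI GA GB); exists y. Qed.

Lemma ultra_ex3 T (G : ultra T) A B C : G A -> G B -> G C ->
  exists y, [/\ A y, B y & C y].
Proof.
move=> GA GB GC; have [y [[? ?] ?]] := ultra_ex2 (filterI GA GB) GC.
by exists y.
Qed.

Definition ultra_ret T (x : T) : ultra T.
Proof.
exists [set A | A x].
  split=> [|]; first exact.
  by split => //= A B sAB; exact: sAB.
by move=> A /=; exact: EM.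
Defined.

Definition ultra_map T S (phi : T -> S) (G : ultra T) : ultra S.
Proof.
exists [set A | G (phi @^-1` A)].
  split => [/=|]; first exact: filter_not_empty.
  split => /=; first exact: filterT.
    by move=> A B; exact: filterI.
  by move=> A B sAB; apply: filterS => x; exact: sAB.
by move=> A /=; exact: (umemVC G (phi @^-1` A)).
Defined.

Definition ultra_bind T S (G : ultra T) (H : T -> ultra S) : ultra S.
Proof.
exists [set A | G [set t | H t A]].
  split=> [/=|].
    by move=> G0; have [t] := filter_ex G0; exact: filter_not_empty.
  split => /=.
  - by apply: filterE => t; exact: filterT.
  - move=> A B; rewrite /= => GA GB.
    by apply: filterS2 GA GB => t; exact: filterI.
  - move=> A B sAB; rewrite /= => GA.
    by apply: filterS GA => t; exact: filterS.
move=> A /=; have [|GA] := umemVC G [set t | H t A]; first by left.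
right; apply: filterS GA => t /= HA.
by have [|//] := umemVC (H t) A.
Defined.

Lemma nonprincipal_ultra :
  exists U : ultra nat, forall n, U [set k | (n <= k)%N].
Proof.
have [U [UU sU]] := @ultraFilterLemma nat \oo _.
exists (Ultra (@ultra_proper _ _ UU) (fun A => in_ultra_setVsetC A UU)).
move=> n; apply: sU; exact: nbhs_infty_ge.
Qed.

(** The value is arbitrary when f has no limit, for instance when it is unbounded
    along G. *)
Definition ulim T (G : ultra T) (f : T -> R) : R :=
  get [set l : R | forall e : R, 0 < e -> G [set y | `|f y - l| <= e]].

Definition ubounded T (G : ultra T) (f : T -> R) : Prop :=
  exists B : R, G [set y | `|f y| <= B].

Lemma ulim_unique T (G : ultra T) f (l : R) :
  (forall e : R, 0 < e -> G [set y | `|f y - l| <= e]) -> ulim G f = l.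
Proof.
move=> fl; rewrite /ulim; set A := [set _ | _].
have Al' : A (get A) by apply: (getPex (ex_intro _ l _)).
apply/eqP/negPn/negP => neq.
have e0 : 0 < `|get A - l| / 3 by rewrite divr_gt0// normr_gt0 subr_eq0.
have [y [/= y1 y2]] := ultra_ex2 (fl _ e0) (Al' _ e0).
have : `|get A - l| <= `|f y - l| + `|f y - get A|.
  by rewrite [leRHS]addrC [X in _ <= X + _]distrC; exact: ler_distD.
have : 0 < `|get A - l| by rewrite normr_gt0 subr_eq0.
lra.
Qed.

(** The limit is the supremum of the lower bounds that hold along the
    ultrafilter. *)
Lemma ulimP T (G : ultra T) (f : T -> R) (e : R) :
  ubounded G f -> 0 < e -> G [set y | `|f y - ulim G f| <= e].
Proof.
move=> [B GB]; move: e.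
suff [l lP] : exists l : R, forall e : R, 0 < e -> G [set y | `|f y - l| <= e].
  by move=> e e0; rewrite (ulim_unique lP); exact: lP.
pose S := [set t : R | G [set y | t <= f y]].
have supS : has_sup S.
  split.
    by exists (- B); apply: filterS GB => y /=; rewrite ler_norml => /andP[].
  exists B => t St; have [y [/= ty]] := ultra_ex2 St GB.
  by rewrite ler_norml => /andP[_]; exact: le_trans.
exists (sup S) => e e0.
have [t St tS] := sup_adherent e0 supS.
have nS : G [set y | f y < sup S + e].
  have [|//] := umemVC G [set y | sup S + e <= f y].
    move=> /(sup_upper_bound supS); lra.
  by apply: filterS => y /= /negP; rewrite ltNge.
by apply: filterS2 St nS => y /= ty yS; rewrite ler_norml; apply/andP; lra.
Qed.

Lemma ubounded_cst T (G : ultra T) (c : R) : ubounded G (fun=> c).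
Proof. by exists `|c|; apply: filterE => y /=. Qed.

Lemma uboundedD T (G : ultra T) (f g : T -> R) :
  ubounded G f -> ubounded G g -> ubounded G (fun y => f y + g y).
Proof.
move=> [B GB] [C GC]; exists (B + C); apply: filterS2 GB GC => y /= fB gC.
by rewrite (le_trans (ler_normD _ _))// lerD.
Qed.

Lemma uboundedZ T (G : ultra T) (c : R) f :
  ubounded G f -> ubounded G (fun y => c * f y).
Proof.
move=> [B GB]; exists (`|c| * B); apply: filterS GB => y /= fB.
by rewrite normrM ler_wpM2l.
Qed.

Lemma ulim_cst T (G : ultra T) (c : R) : ulim G (fun=> c) = c.
Proof.
by apply: ulim_unique => e e0; apply: filterE => y /=; rewrite subrr normr0 ltW.
Qed.

Lemma ulim_ret T (x : T) (f : T -> R) : ulim (ultra_ret x) f = f x.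
Proof. by apply: ulim_unique => e e0 /=; rewrite subrr normr0 ltW. Qed.

Lemma ulim_map T S (phi : T -> S) G (f : S -> R) :
  ulim (ultra_map phi G) f = ulim G (f \o phi).
Proof. by []. Qed.

Lemma ulim_bind T S (G : ultra T) (H : T -> ultra S) (f : S -> R) :
  ubounded (ultra_bind G H) f ->
  ulim (ultra_bind G H) f = ulim G (fun t => ulim (H t) f).
Proof.
move=> fb; apply/esym; apply: ulim_unique => e e0.
have := ulimP fb e0; case: fb => B; rewrite /= => fB GH.
apply: filterS2 fB GH => t HB Ht.
apply/ler_addgt0Pl => d d0.
have tb : ubounded (H t) f by exists B.
have [y [/= y1 y2]] := ultra_ex2 (ulimP tb d0) Ht.
set l := ulim _ f in y2 *; set m := ulim _ f in y1 *.
rewrite (le_trans _ (lerD y1 y2))//.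
by rewrite [X in _ <= X + _]distrC; exact: ler_distD.
Qed.

Lemma le_ulim T (G : ultra T) (f g : T -> R) :
  ubounded G f -> ubounded G g -> G [set y | f y <= g y] -> ulim G f <= ulim G g.
Proof.
move=> fb gb fg; apply/ler_addgt0Pr => e e0.
have e20 : 0 < e / 2 by rewrite divr_gt0.
have [y [/= y1 y2 y3]] := ultra_ex3 (ulimP fb e20) (ulimP gb e20) fg.
by move: y1 y2; rewrite !ler_norml => /andP[? ?] /andP[? ?]; lra.
Qed.

Lemma ulim_le_cst T (G : ultra T) f (c : R) :
  ubounded G f -> G [set y | f y <= c] -> ulim G f <= c.
Proof.
move=> fb fc; rewrite -[leRHS](ulim_cst G).
exact: le_ulim (ubounded_cst _ _) _.
Qed.

Lemma ulim_ge_cst T (G : ultra T) f (c : R) :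
  ubounded G f -> G [set y | c <= f y] -> c <= ulim G f.
Proof.
move=> fb fc; rewrite -[leLHS](ulim_cst G c).
exact: le_ulim (ubounded_cst _ _) _ _.
Qed.

Lemma ulimD T (G : ultra T) (f g : T -> R) : ubounded G f -> ubounded G g ->
  ulim G (fun y => f y + g y) = ulim G f + ulim G g.
Proof.
move=> fb gb; apply: ulim_unique => e e0.
have e20 : 0 < e / 2 by rewrite divr_gt0.
apply: filterS2 (ulimP fb e20) (ulimP gb e20) => y /= h1 h2.
rewrite opprD addrACA (le_trans (ler_normD _ _))//; lra.
Qed.

Lemma ulimZ T (G : ultra T) (c : R) f : ubounded G f ->
  ulim G (fun y => c * f y) = c * ulim G f.
Proof.
move=> fb; apply: ulim_unique => e e0.
have d0 : 0 < e / (`|c| + 1) by rewrite divr_gt0// ltr_pwDr.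
apply: filterS (ulimP fb d0) => y /= h; rewrite -mulrBr normrM.
rewrite (le_trans (ler_wpM2l _ h))// mulrCA ger_pMr//.
by rewrite ler_pdivrMr ?mul1r ?lerDl// ltr_pwDr.
Qed.

Lemma eq_ulim T (G : ultra T) (f g : T -> R) : f =1 g -> ulim G f = ulim G g.
Proof. by move=> fg; congr ulim; apply/funext. Qed.

End ultrafilters.

(** * Iterated limits of the norm, and the convex order on ultrafilters *)

Section iterated_limits.
Context {R : realType} {X : normedModType R}.
Implicit Types (G H : ultra X) (f : X -> R) (s : seq R) (v w : X).

Definition nbounded G : Prop := exists B : R, G [set y | `|y| <= B].

Definition convex_lip f : Prop :=
  (forall x y (t : R), 0 <= t <= 1 ->
     f (t *: x + (1 - t) *: y) <= t * f x + (1 - t) * f y) /\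
  exists2 L : R, 0 <= L & forall x y, `|f x - f y| <= L * `|x - y|.

Definition shift G (a : R) f : X -> R := fun v => ulim G (fun y => f (v + a *: y)).

(** The first coefficient belongs to the outermost limit, hence to the vector
    chosen first.  The base point v is kept as an argument, since it collects the
    vectors already chosen. *)
Definition iter_norm G s : X -> R := foldr (shift G) (fun v => `|v|) s.

Lemma convex_lip_norm : convex_lip (fun v => `|v|).
Proof.
split=> [x y t /andP[t0 t1]|].
  by rewrite (le_trans (ler_normD _ _))// !normrZ !ger0_norm// subr_ge0.
by exists 1 => // x y; rewrite mul1r; exact: ler_dist_dist.
Qed.

Lemma convex_lip_comp f v a : convex_lip f -> convex_lip (fun y => f (v + a *: y)).
Proof.
move=> [fc [L L0 fL]]; split=> [x y t t01|].
  apply: le_trans (fc _ _ _ t01); rewrite le_eqVlt; apply/orP; left; apply/eqP.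
  congr f; rewrite !scalerDr !scalerA addrACA -scalerDl subrKC scale1r.
  by rewrite (mulrC a) (mulrC a).
exists (L * `|a|); first by rewrite mulr_ge0.
move=> x y; rewrite (le_trans (fL _ _))// -mulrA -normrZ.
by rewrite scalerBr opprD addrACA subrr add0r.
Qed.

Lemma convex_lip_ubounded G f : nbounded G -> convex_lip f -> ubounded G f.
Proof.
move=> [B GB] [_ [L L0 fL]]; exists (`|f 0| + L * B).
apply: filterS GB => y /= yB; rewrite -[f y](subrKC (f 0)).
rewrite (le_trans (ler_normD _ _))// lerD2l (le_trans (fL _ _))// subr0.
exact: ler_wpM2l.
Qed.

Lemma shift_ubounded G f v a : nbounded G -> convex_lip f ->
  ubounded G (fun y => f (v + a *: y)).
Proof. by move=> Gb /(convex_lip_comp v a); exact: convex_lip_ubounded. Qed.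

Lemma convex_lip_shift G f a : nbounded G -> convex_lip f -> convex_lip (shift G a f).
Proof.
move=> Gb fcl; have fb v := shift_ubounded v a Gb fcl.
have [fc [L L0 fL]] := fcl; split=> [x y t t01|].
  rewrite /shift -!ulimZ//= -ulimD; [|exact: uboundedZ..].
  apply: le_ulim => //; first by apply: uboundedD; exact: uboundedZ.
  apply: filterE => u /=; apply: le_trans (fc _ _ _ t01).
  rewrite le_eqVlt; apply/orP; left; apply/eqP.
  by congr f; rewrite !scalerDr addrACA -scalerDl subrKC scale1r.
have shL x y : shift G a f x <= shift G a f y + L * `|x - y|.
  rewrite /shift -[X in _ + X](ulim_cst G) -ulimD//; last exact: ubounded_cst.
  apply: le_ulim => //; first by apply: uboundedD => //; exact: ubounded_cst.
  apply: filterE => u /=.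
  have := fL (x + a *: u) (y + a *: u).
  rewrite opprD addrACA subrr addr0 ler_norml => /andP[_]; lra.
exists L => // x y; rewrite ler_norml.
have := shL x y; have := shL y x; rewrite distrC => ? ?; apply/andP; lra.
Qed.

Lemma convex_lip_iter_norm G s : nbounded G -> convex_lip (iter_norm G s).
Proof.
move=> Gb; elim: s => [|a s IH] /=; first exact: convex_lip_norm.
exact: convex_lip_shift.
Qed.

Lemma iter_norm_ubounded G s v a : nbounded G ->
  ubounded G (fun y => iter_norm G s (v + a *: y)).
Proof. by move=> Gb; apply: shift_ubounded => //; exact: convex_lip_iter_norm. Qed.

Lemma iter_normZ G s v c : nbounded G ->
  iter_norm G [seq c * x | x <- s] (c *: v) = `|c| * iter_norm G s v.
Proof.
move=> Gb; elim: s v => [|a s IH] v /=; first by rewrite normrZ.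
rewrite /shift -ulimZ; last exact: iter_norm_ubounded.
by apply: eq_ulim => y; rewrite -IH scalerDr scalerA.
Qed.

Lemma mkseq_cons T (a : nat -> T) n : mkseq a n.+1 = a 0%N :: mkseq (a \o S) n.
Proof. by rewrite /mkseq /= -[1%N]addn0 iotaDl -map_comp. Qed.

Lemma iter_normD G n (a b : nat -> R) v w : nbounded G ->
  iter_norm G (mkseq (a \+ b) n) (v + w) <=
  iter_norm G (mkseq a n) v + iter_norm G (mkseq b n) w.
Proof.
move=> Gb; elim: n a b v w => [|n IH] a b v w; first exact: ler_normD.
rewrite !mkseq_cons /= /shift -ulimD; [|exact: iter_norm_ubounded..].
apply: le_ulim; first exact: iter_norm_ubounded.
  by apply: uboundedD; exact: iter_norm_ubounded.
by apply: filterE => y /=; rewrite scalerDl addrACA; exact: IH.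
Qed.

Lemma iter_norm_ge0 G s v : nbounded G -> 0 <= iter_norm G s v.
Proof.
move=> Gb; elim: s v => [|a s IH] v //=.
apply: ulim_ge_cst; first exact: iter_norm_ubounded.
by apply: filterE => y /=.
Qed.

Lemma iter_norm_ub G (B : R) s v : G [set y | `|y| <= B] ->
  iter_norm G s v <= `|v| + B * \sum_(x <- s) `|x|.
Proof.
move=> GB; have Gb : nbounded G by exists B.
elim: s v => [|a s IH] v /=; first by rewrite big_nil mulr0 addr0.
apply: ulim_le_cst; first exact: iter_norm_ubounded.
apply: filterS GB => y /= yB; rewrite (le_trans (IH _))// big_cons mulrDr addrA.
rewrite lerD2r (le_trans (ler_normD _ _))// lerD2l normrZ mulrC.
exact: ler_wpM2r.
Qed.

Lemma iter_norm_cat G s t : iter_norm G (s ++ t) = foldr (shift G) (iter_norm G t) s.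
Proof. exact: foldr_cat. Qed.

Lemma shift0 G f : shift G 0 f = f.
Proof.
apply/funext => v; rewrite /shift -[RHS](ulim_cst G).
by apply: eq_ulim => y; rewrite scale0r addr0.
Qed.

Lemma iter_norm_filter G s : iter_norm G [seq x <- s | x != 0] = iter_norm G s.
Proof.
by elim: s => //= a s IH; case: eqP => /= [->|_]; rewrite IH// shift0.
Qed.

Lemma iter_norm_nseq0 G n s : iter_norm G (nseq n 0 ++ s) = iter_norm G s.
Proof. by elim: n => //= n ->; rewrite shift0. Qed.

Lemma iter_norm_lip G (B : R) n (a b : nat -> R) v w : G [set y | `|y| <= B] ->
  `|iter_norm G (mkseq a n) v - iter_norm G (mkseq b n) w| <=
  `|v - w| + B * \sum_(i < n) `|a i - b i|.
Proof.
move=> GB; have Gb : nbounded G by exists B.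
have one (c d : nat -> R) x y : iter_norm G (mkseq c n) x <=
    iter_norm G (mkseq d n) y + (`|x - y| + B * \sum_(i < n) `|c i - d i|).
  rewrite -{1}[x](subrKC y) {1}(_ : c = d \+ (c \- d)); last first.
    by apply/funext => i /=; rewrite subrKC.
  rewrite (le_trans (iter_normD _ _ _ _ _ Gb))// lerD2l.
  rewrite (le_trans (iter_norm_ub _ _ GB))//.
  by rewrite big_map -{1}[n]subn0 big_mkord.
have := one a b v w; have := one b a w v; rewrite distrC.
rewrite (eq_bigr (fun i : 'I_n => `|a i - b i|)); last by move=> i _; rewrite distrC.
by move=> ? ?; rewrite ler_norml; apply/andP; lra.
Qed.

(** ** Sums, dilates and blocks of ultrafilters *)

Definition ultra_add G H : ultra X :=
  ultra_bind G (fun y => ultra_map (fun z => y + z) H).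

Definition ultra_scale (c : R) G : ultra X := ultra_map ( *:%R c) G.

Definition ultra_block G (b : seq R) : ultra X :=
  foldr (fun c => ultra_add (ultra_scale c G)) (ultra_ret 0) b.

Lemma nbounded_add G H : nbounded G -> nbounded H -> nbounded (ultra_add G H).
Proof.
move=> [B GB] [C HC]; exists (B + C) => /=; apply: filterS GB => y /= yB.
apply: filterS HC => z /= zC.
by rewrite (le_trans (ler_normD _ _))// lerD.
Qed.

Lemma nbounded_scale c G : nbounded G -> nbounded (ultra_scale c G).
Proof.
move=> [B GB]; exists (`|c| * B); rewrite /= ; apply: filterS GB => y /= yB.
by rewrite normrZ ler_wpM2l.
Qed.

Lemma nbounded_ret v : nbounded (ultra_ret v).
Proof. by exists `|v| => /=. Qed.

Lemma nbounded_block G b : nbounded G -> nbounded (ultra_block G b).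
Proof.
move=> Gb; elim: b => [|c b IH] /=; first exact: nbounded_ret.
by apply: nbounded_add => //; exact: nbounded_scale.
Qed.

Lemma shift_scale c G a f : shift (ultra_scale c G) a f = shift G (a * c) f.
Proof.
by apply/funext => v; rewrite /shift ulim_map; apply: eq_ulim => y /=; rewrite scalerA.
Qed.

Lemma shift_add G H a f : nbounded G -> nbounded H -> convex_lip f ->
  shift (ultra_add G H) a f = shift G a (shift H a f).
Proof.
move=> Gb Hb fcl; apply/funext => v; rewrite /shift ulim_bind.
  apply: eq_ulim => y; rewrite ulim_map; apply: eq_ulim => z /=.
  by rewrite scalerDr addrA.
by apply: shift_ubounded => //; exact: nbounded_add.
Qed.

Lemma ulim_add G H f : nbounded G -> nbounded H -> convex_lip f ->
  ulim (ultra_add G H) f = ulim G (fun y => ulim H (fun z => f (y + z))).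
Proof.
move=> Gb Hb fcl; have /(congr1 (@^~ 0)) := shift_add 1 Gb Hb fcl.
rewrite /shift => eq1; transitivity (ulim (ultra_add G H) (fun y => f (0 + 1 *: y))).
  by apply: eq_ulim => y; rewrite add0r scale1r.
rewrite eq1; apply: eq_ulim => y; apply: eq_ulim => z.
by rewrite add0r !scale1r.
Qed.

Lemma shift_block G b a f : nbounded G -> convex_lip f ->
  shift (ultra_block G b) a f = foldr (shift G) f [seq a * x | x <- b].
Proof.
move=> Gb fcl; elim: b => [|c b IH] /=.
  by apply/funext => v; rewrite /shift ulim_ret scaler0 addr0.
rewrite shift_add//; last exact: nbounded_block.
  by rewrite shift_scale IH.
exact: nbounded_scale.
Qed.

(** Unfolding blocks is how tensor products enter: uniform equivalence of a
    spreading model with those of its blocks becomes multiplicativity. *)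
Lemma iter_norm_block G b s : nbounded G ->
  iter_norm (ultra_block G b) s = iter_norm G [seq x * y | x <- s, y <- b].
Proof.
move=> Gb; elim: s => //= a s ->; rewrite iter_norm_cat shift_block//.
exact: convex_lip_iter_norm.
Qed.

Lemma iter_norm_scale c G s :
  iter_norm (ultra_scale c G) s = iter_norm G [seq x * c | x <- s].
Proof. by elim: s => //= a s ->; rewrite shift_scale. Qed.

(** ** The convex order *)

(** The order of Choquet theory.  Being above the unit mass at 0, that is null, is
    what Mazur's theorem gives for weakly null sequences. *)
Definition convex_ge G H : Prop := forall f, convex_lip f -> ulim H f <= ulim G f.

Definition null_ultra G : Prop := forall f, convex_lip f -> f 0 <= ulim G f.

Lemma convex_ge_shift G H a f v : convex_ge G H -> convex_lip f ->
  shift H a f v <= shift G a f v.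
Proof. by move=> GH /(convex_lip_comp v a); exact: GH. Qed.

Lemma convex_ge_iter_norm G H s v : nbounded G -> nbounded H -> convex_ge G H ->
  iter_norm H s v <= iter_norm G s v.
Proof.
move=> Gb Hb GH; elim: s v => [|a s IH] v //=.
apply: le_trans (convex_ge_shift _ _ GH (convex_lip_iter_norm _ _)) => //.
apply: le_ulim; [exact: iter_norm_ubounded| |by apply: filterE => y /=].
by apply: shift_ubounded => //; exact: convex_lip_iter_norm.
Qed.

Lemma null_shift G a f v : null_ultra G -> convex_lip f -> f v <= shift G a f v.
Proof.
by move=> G0 /(convex_lip_comp v a)/G0; rewrite scaler0 addr0.
Qed.

Lemma null_ret : null_ultra (ultra_ret 0).
Proof. by move=> f _; rewrite ulim_ret. Qed.

Lemma null_scale c G : null_ultra G -> null_ultra (ultra_scale c G).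
Proof.
move=> G0 f fcl; have := null_shift c 0 G0 fcl; rewrite /shift ulim_map.
by under eq_ulim do rewrite add0r.
Qed.

Lemma convex_ge_addl G H : nbounded G -> nbounded H -> null_ultra H ->
  convex_ge (ultra_add G H) G.
Proof.
move=> Gb Hb H0 f fcl; rewrite ulim_add//; apply: le_ulim.
- exact: convex_lip_ubounded.
- have /(convex_lip_shift 1 Hb) := fcl => /(convex_lip_ubounded Gb).
  by rewrite /shift; under eq_fun do under eq_ulim do rewrite scale1r.
- apply: filterE => y /=; have := null_shift 1 y H0 fcl.
  by rewrite /shift; under eq_ulim do rewrite scale1r.
Qed.

Lemma convex_ge_addr G H : nbounded G -> nbounded H -> null_ultra G ->
  convex_ge (ultra_add G H) H.
Proof.
move=> Gb Hb G0 f fcl; rewrite ulim_add//.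
have := G0 _ (convex_lip_shift 1 Hb fcl); rewrite /shift.
under eq_ulim do rewrite add0r scale1r.
by under [X in _ <= X -> _]eq_ulim do under eq_ulim do rewrite scale1r.
Qed.

Lemma convex_ge_null G H : convex_ge G H -> null_ultra H -> null_ultra G.
Proof. by move=> GH H0 f fcl; apply: le_trans (GH _ fcl); exact: H0. Qed.

Lemma null_add G H : nbounded G -> nbounded H -> null_ultra G -> null_ultra H ->
  null_ultra (ultra_add G H).
Proof.
by move=> Gb Hb G0 H0; apply: (convex_ge_null _ G0); exact: convex_ge_addl.
Qed.

Lemma null_block G b : nbounded G -> null_ultra G -> null_ultra (ultra_block G b).
Proof.
move=> Gb G0; elim: b => [|c b IH] /=; first exact: null_ret.
apply: null_add IH; first exact: nbounded_scale.
  exact: nbounded_block.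
exact: null_scale.
Qed.

Lemma null_iter_norm_cons G s a v : nbounded G -> null_ultra G ->
  iter_norm G s v <= iter_norm G (a :: s) v.
Proof. by move=> Gb G0; apply: null_shift => //; exact: convex_lip_iter_norm. Qed.

(** By convexity, shrinking one coordinate gives at most the average of keeping and
    suppressing it, and suppressing it does not increase the norm. *)
Lemma null_iter_norm_le G n (t a : nat -> R) v : nbounded G -> null_ultra G ->
  (forall i, 0 <= t i <= 1) ->
  iter_norm G (mkseq (t \* a) n) v <= iter_norm G (mkseq a n) v.
Proof.
move=> Gb G0; elim: n t a v => [|n IH] t a v t01 //.
rewrite !mkseq_cons /=; set f := iter_norm G (mkseq (a \o S) n).
have fcl : convex_lip f by exact: convex_lip_iter_norm.
apply: (@le_trans _ _ (shift G (t 0%N * a 0%N) f v)).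
  apply: le_ulim; first exact: iter_norm_ubounded.
    exact: shift_ubounded.
  apply: filterE => y /=.
  by apply: (IH (t \o S) (a \o S)) => i; exact: t01.
have /andP[t0 t1] := t01 0%N.
apply: (@le_trans _ _ (t 0%N * shift G (a 0%N) f v + (1 - t 0%N) * f v)).
  rewrite /shift -ulimZ; last exact: shift_ubounded.
  rewrite -[X in _ + X](ulim_cst G) -ulimD;
    [|by apply: uboundedZ; exact: shift_ubounded|exact: ubounded_cst].
  apply: le_ulim; first exact: shift_ubounded.
    apply: uboundedD; last exact: ubounded_cst.
    by apply: uboundedZ; exact: shift_ubounded.
  apply: filterE => y /=; apply: le_trans (fcl.1 _ _ _ (t01 0%N)).
  rewrite le_eqVlt; apply/orP; left; apply/eqP.
  congr f; rewrite scalerDr scalerA addrAC -scalerDl subrKC scale1r.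
  by [].
have fs : f v <= shift G (a 0%N) f v by exact: null_shift.
have := ler_wpM2l (_ : 0 <= 1 - t 0%N) fs; rewrite subr_ge0 => /(_ t1); lra.
Qed.

End iterated_limits.

(** * Ultrafilters dominating the origin in the convex order *)

Section null_criteria.
Context {R : realType} {X : normedModType R}.
Implicit Types (G : ultra X) (f : X -> R).

(** Leaving the missing mass on a base point x keeps the induction within convex
    combinations of total mass one. *)
Lemma jensen f (p : seq (R * X)) x :
  convex_lip f -> (forall q : R * X, q \in p -> 0 <= q.1) -> \sum_(q <- p) q.1 <= 1 ->
  f ((1 - \sum_(q <- p) q.1) *: x + \sum_(q <- p) q.1 *: q.2) <=
  (1 - \sum_(q <- p) q.1) * f x + \sum_(q <- p) q.1 * f q.2.
Proof.
move=> [fc _]; elim: p x => [|[w y] p IH] x p0.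
  by rewrite !big_nil !addr0 subr0 scale1r mul1r.
have w0 : 0 <= w := p0 (w, y) (mem_head _ _).
have {}p0 q : q \in p -> 0 <= q.1 by move=> qp; apply: p0; rewrite inE qp orbT.
rewrite !big_cons /=; set W := \sum_(q <- p) q.1; set S := \sum_(q <- p) _ *: _.
set T := \sum_(q <- p) _ * _ => wW1.
have W1 : W <= 1 by lra.
have [W1e|W1ne] := eqVneq (1 - W) 0.
  have -> : w = 0 by lra.
  have := IH x p0 W1; rewrite -/W -/S -/T add0r W1e !scale0r !mul0r !add0r.
  by [].
have W1p : 0 < 1 - W by rewrite lt_neqAle eq_sym W1ne subr_ge0.
(* the first two points are merged into the barycentre z *)
pose t := w / (1 - W).
have t01 : 0 <= t <= 1.
  apply/andP; split; first by rewrite divr_ge0// ltW.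
  by rewrite /t ler_pdivrMr// mul1r; lra.
pose z := t *: y + (1 - t) *: x.
have tW : (1 - W) * t = w by rewrite mulrC divfK.
have := IH z p0 W1; rewrite -/W -/S -/T.
have -> : (1 - W) *: z + S = (1 - (w + W)) *: x + (w *: y + S).
  rewrite scalerDr !scalerA tW mulrBr tW mulr1 -addrA addrCA.
  by congr (_ *: _ + _); lra.
move=> /le_trans; apply.
have := ler_wpM2l (ltW W1p) (fc y x t t01); rewrite -/z => zT.
have -> : (1 - (w + W)) * f x + (w * f y + T) =
    (1 - W) * (t * f y + (1 - t) * f x) + T by rewrite -tW; ring.
by rewrite lerD2r.
Qed.

(** The limits are realized one after the other, each by a vector of A. *)
Lemma iter_norm_pick G A s v (e : R) : nbounded G -> G A -> iter_norm G s v < e ->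
  exists p : seq (R * X), [/\ unzip1 p = s, forall q : R * X, q \in p -> A q.2 &
    `|v + \sum_(q <- p) q.1 *: q.2| < e].
Proof.
move=> Gb GA; elim: s v => [|a s IH] v /= ve.
  by exists [::]; split=> //; rewrite big_nil addr0.
have d0 : 0 < (e - shift G a (iter_norm G s) v) / 2 by lra.
have [y [Ay /= yv]] := ultra_ex2 GA (ulimP (iter_norm_ubounded s v a Gb) d0).
have ye : iter_norm G s (v + a *: y) < e.
  by move: yv; rewrite -/(shift G a (iter_norm G s) v) ler_norml => /andP[_]; lra.
have [p [ps pA pe]] := IH _ ye.
exists ((a, y) :: p); split; first by rewrite /= ps.
  by move=> q; rewrite inE => /orP[/eqP->//|]; exact: pA.
by rewrite big_cons addrA.
Qed.

(** A convex function is at most its limit at a convex combination of generic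
    vectors, and such a combination can be made as small as one likes. *)
Lemma null_small_combination G : nbounded G ->
  (forall e : R, 0 < e -> exists s : seq R, [/\ forall x, x \in s -> 0 <= x,
     \sum_(x <- s) x = 1 & iter_norm G s 0 < e]) ->
  null_ultra G.
Proof.
move=> Gb small f fcl; have [_ [L L0 fL]] := fcl.
apply/ler_addgt0Pr => e e0.
have d0 : 0 < e / (L + 1) by rewrite divr_gt0// ltr_pwDr.
have [s [s0 s1 se]] := small _ d0.
have GA := ulimP (convex_lip_ubounded Gb fcl) d0.
have [p [ps pA]] := iter_norm_pick Gb GA se; rewrite add0r => pe.
have sump : \sum_(q <- p) q.1 = 1.
  by rewrite -s1 -ps /unzip1 big_map.
have p0 q : q \in p -> 0 <= q.1.
  by move=> qp; apply: s0; rewrite -ps; apply: map_f.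
have := jensen 0 fcl p0; rewrite sump => /(_ (lexx _)).
rewrite subrr scale0r mul0r !add0r => fp.
have fpl : \sum_(q <- p) q.1 * f q.2 <= ulim G f + e / (L + 1).
  rewrite -[leRHS]mul1r -{1}sump mulr_suml big_seq [leRHS]big_seq.
  apply: ler_sum => q qp.
  apply: ler_wpM2l; first exact: p0.
  have := pA _ qp; rewrite /= ler_norml => /andP[_]; lra.
have := fL 0 (\sum_(q <- p) q.1 *: q.2); rewrite sub0r normrN ler_norml => /andP[_ f0].
have pL := ler_wpM2l L0 (ltW pe).
have eE : e = L * (e / (L + 1)) + e / (L + 1).
  by rewrite -[X in _ = _ + X]mul1r -mulrDl mulrC divfK// gt_eqF// ltr_pwDr.
lra.
Qed.

(** The differences y - z of successive generic vectors telescope, so that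
    their averages tend to zero. *)
Lemma null_difference G : nbounded G -> null_ultra (ultra_block G [:: 1; -1]).
Proof.
move=> Gb f fcl; have [_ [L L0 fL]] := fcl; have [B GB] := Gb.
set l := ulim _ f.
pose g y := ulim G (fun z => f (y - z)).
have gE : g = shift G (-1) f.
  by apply/funext => y; apply: eq_ulim => z; rewrite scaleN1r.
have gcl : convex_lip g by rewrite gE; exact: convex_lip_shift.
have lE : l = ulim G g.
  have /(congr1 (@^~ 0)) := shift_block [:: 1; -1] 1 Gb fcl.
  rewrite /= !mul1r -gE /shift => e1.
  transitivity (ulim G (fun y => g (0 + 1 *: y))); last first.
    by apply: eq_ulim => y; rewrite add0r scale1r.
  by rewrite -e1; apply: eq_ulim => y; rewrite add0r scale1r.
have B0 : 0 <= B by have [y /= /(le_trans (normr_ge0 _))] := ultra_ex GB.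
apply/ler_addgt0Pr => e e0.
have e20 : 0 < e / 3 by rewrite divr_gt0.
pose A := [set y | g y <= l + e / 3 /\ `|y| <= B].
have GA : G A.
  apply: filterS2 GB (ulimP (convex_lip_ubounded Gb gcl) e20) => y /= yB.
  by rewrite -lE ler_norml => /andP[_ ?]; split=> //; lra.
(* a chain of generic vectors whose consecutive differences are generic *)
have chain n : exists y : nat -> X, (forall i, (i <= n)%N -> A (y i)) /\
    (forall i, (i < n)%N -> f (y i - y i.+1) <= l + e / 3 + e / 3).
  elim: n => [|n [y [yA yf]]].
    by have [y Ay] := ultra_ex GA; exists (fun=> y).
  have [gy _] := yA n (leqnn n).
  have Gf : G [set z | f (y n - z) <= l + e / 3 + e / 3].
    have fb : ubounded G (fun z => f (y n - z)).
      have := shift_ubounded (y n) (-1) Gb fcl.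
      by under eq_fun do rewrite scaleN1r.
    apply: filterS (ulimP fb e20) => z /=; rewrite -/(g (y n)) ler_norml => /andP[_].
    lra.
  have [z [Az /= fz]] := ultra_ex2 GA Gf.
  exists (fun i => if (i <= n)%N then y i else z); split=> i.
    by move=> _; case: ifPn => // ?; exact: yA.
  rewrite ltnS => ilen; rewrite ilen; have [|iltn] := leqP n i.
    by move=> nlei; have -> : i = n by apply/eqP; rewrite eqn_leq ilen.
  exact: yf.
have [n nB] : exists n : nat, L * (2 * B) <= e / 3 * n.+1%:R.
  pose r := L * (2 * B) / (e / 3).
  exists (Num.bound `|r|).
  have rb : `|r| < (Num.bound `|r|)%:R by exact: archi_boundP.
  rewrite [leRHS]mulrC -ler_pdivrMr// -/r (le_trans (ler_norm _))//.
  by rewrite (le_trans (ltW rb))// ler_nat.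
have [y [yA yf]] := chain n.+1.
pose p := [seq (n.+1%:R^-1 : R, y i - y i.+1) | i <- index_iota 0 n.+1].
have p0 q : q \in p -> 0 <= q.1 by move=> /mapP[i _ ->] /=.
have sump : \sum_(q <- p) q.1 = 1.
  by rewrite big_map /= sumr_const_nat subn0 -[LHS]mulr_natl mulfV ?pnatr_eq0.
have sumpy : \sum_(q <- p) q.1 *: q.2 = n.+1%:R^-1 *: (y 0%N - y n.+1).
  rewrite big_map /= -scaler_sumr; congr (_ *: _).
  under eq_bigr do rewrite -opprB; rewrite sumrN telescope_sumr//.
  by rewrite opprB.
have := jensen 0 fcl p0; rewrite sump sumpy => /(_ (lexx _)).
rewrite subrr scale0r mul0r !add0r => fp.
have fpl : \sum_(q <- p) q.1 * f q.2 <= l + e / 3 + e / 3.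
  rewrite -[leRHS]mul1r -{1}sump mulr_suml big_seq [leRHS]big_seq.
  apply: ler_sum => q qp.
  apply: ler_wpM2l; first exact: p0.
  move: qp => /mapP[i]; rewrite mem_index_iota => /andP[_ iltn] -> /=.
  exact: yf.
set u := _ *: _ in fp.
have ub : L * `|u| <= e / 3.
  rewrite normrZ gtr0_norm ?invr_gt0// mulrCA mulrC ler_pdivrMr//.
  rewrite (le_trans _ nB)// ler_wpM2l// (le_trans (ler_normB _ _))//.
  have [_ ?] := yA 0%N isT; have [_ ?] := yA n.+1 (leqnn _); lra.
have := fL 0 u; rewrite sub0r normrN ler_norml => /andP[_ f0].
lra.
Qed.

End null_criteria.

(** * Schauder basic sequences *)

Section basic_sequences.
Context {R : realType} {E : completeNormedModType R}.
Implicit Types (y : E ^nat) (c : R ^nat).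

Lemma partial_coef y c i :
  c i *: y i = \sum_(j < i.+1) c j *: y j - \sum_(j < i) c j *: y j.
Proof. by rewrite big_ord_recr /= [X in X - _]addrC addrK. Qed.

Lemma partial_coef_le y (K : R) c i n : (i < n)%N ->
  (forall c m n, (m <= n)%N ->
     `|\sum_(i < m) c i *: y i| <= K * `|\sum_(i < n) c i *: y i|) ->
  `|c i| * `|y i| <= 2 * K * `|\sum_(i < n) c i *: y i|.
Proof.
move=> iltn Ky; rewrite -normrZ partial_coef (le_trans (ler_normB _ _))//.
have := Ky c _ _ iltn; have := Ky c _ _ (ltnW iltn); lra.
Qed.

(** Grunblum's criterion: when the partial sum projections are uniformly bounded
    on the span, they extend to its closure, and the coordinates of a vector of
    the closure are the limits of those of its approximations. *)
Lemma basic_sequence_grunblum y (K : R) : (forall i, y i != 0) -> 0 <= K ->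
  (forall c m n, (m <= n)%N ->
     `|\sum_(i < m) c i *: y i| <= K * `|\sum_(i < n) c i *: y i|) ->
  basic_sequence y.
Proof.
move=> y0 K0 Ky u clu.
pose S c n := \sum_(i < n) c i *: y i.
have SB c d n : S c n - S d n = S (c \- d) n.
  by rewrite -sumrB; apply: eq_bigr => i _; rewrite -scalerBl.
have appr j : exists dN : (nat -> R) * nat,
    forall n, (dN.2 <= n)%N -> `|S dN.1 n - u| <= j.+1%:R^-1.
  have j0 : 0 < j.+1%:R^-1 :> R by [].
  have [v [[N [d ->]] uv]] := clu _ (nbhsx_ballx u _ j0).
  move: uv; rewrite -ball_normE /= => uv.
  exists ((fun i => if insub i is Some i' then d i' else 0), N) => n /= Nn.
  rewrite distrC (le_trans _ (ltW uv))//.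
  rewrite le_eqVlt; apply/orP; left; apply/eqP; congr (`|_ - _|).
  rewrite /S -!(big_mkord xpredT (fun i => (if insub i is Some i' then d i' else 0) *: y i)).
  rewrite (big_cat_nat _ Nn)//= [X in _ + X](_ : _ = 0) ?addr0; last first.
    rewrite big_nat big1// => i /andP[Ni _].
    by rewrite insubF ?scale0r// ltnNge Ni.
  by rewrite big_mkord; apply: eq_bigr => i _; rewrite valK.
have [dN dNP] := choice appr; pose d j := (dN j).1.
have dSS j k m : `|S (d j) m - S (d k) m| <= K * (j.+1%:R^-1 + k.+1%:R^-1).
  pose n := maxn m (maxn (dN j).2 (dN k).2).
  have mn : (m <= n)%N by rewrite leq_maxl.
  rewrite SB (le_trans (Ky _ _ _ mn))// ler_wpM2l// -/(S _ _) -SB.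
  have := dNP j n; have := dNP k n; rewrite !leq_max !leqnn !orbT.
  move=> /(_ isT) h1 /(_ isT) h2; rewrite (le_trans (ler_distD u _ _))//.
  by rewrite lerD// distrC.
have [U Unp] := nonprincipal_ultra.
have inv1 j : j.+1%:R^-1 <= 1 :> R by rewrite invf_le1 ?ler1n.
have db i : ubounded U (fun j => d j i).
  exists (`|d 0%N i| + 2 * K * (K * 2) / `|y i|); apply: filterE => j /=.
  rewrite -[d j i](subrKC (d 0%N i)) (le_trans (ler_normD _ _))// lerD2l.
  rewrite ler_pdivlMr ?normr_gt0//.
  rewrite (le_trans (@partial_coef_le y K (d j \- d 0%N) i i.+1 (leqnn _) Ky))//.
  rewrite ler_wpM2l ?mulr_ge0// -/(S _ _) -SB (le_trans (dSS _ _ _))//.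
  by rewrite ler_wpM2l// invr1 -[2]/(1 + 1) lerD2r.
pose c i := ulim U (fun j => d j i).
have dc m e : 0 < e -> U [set k | `|S (d k) m - S c m| <= e].
  elim: m e => [|m IH] e e0.
    by apply: filterE => k /=; rewrite /S !big_ord0 subrr normr0 ltW.
  have e20 : 0 < e / 2 by rewrite divr_gt0.
  have ey0 : 0 < e / 2 / `|y m| by rewrite divr_gt0// normr_gt0.
  apply: filterS2 (IH _ e20) (ulimP (db m) ey0) => k /= h1.
  rewrite -/(c m) ler_pdivlMr ?normr_gt0// -normrZ => h2.
  rewrite /S !big_ord_recr /= opprD addrACA -scalerBl -/(S _ _) -/(S c _).
  by rewrite (le_trans (ler_normD _ _))//; lra.
have cS j m : `|S c m - S (d j) m| <= K * (2 * j.+1%:R^-1).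
  apply/ler_addgt0Pr => e e0.
  have [k [/= kc jk]] := ultra_ex2 (dc m e e0) (Unp j).
  rewrite [leRHS]addrC (le_trans (ler_distD (S (d k) m) _ _))//.
  rewrite lerD//; first by rewrite distrC.
  rewrite (le_trans (dSS _ _ _))// ler_wpM2l//.
  have : k.+1%:R^-1 <= j.+1%:R^-1 :> R by rewrite lef_pV2 ?posrE// ler_nat ltnS.
  by move=> kj; rewrite mulr_natl mulr2n lerD2r.
have uniq0 e : series (fun i => e i *: y i) @ \oo --> (0 : E) -> e = 0.
  move=> Se; apply/funext => i; apply/eqP; rewrite -[_ == _]negbK; apply/negP => ei.
  have ei0 : 0 < `|e i| * `|y i| by rewrite mulr_gt0 ?normr_gt0.
  have K10 : 0 < 2 * K + 1 by rewrite ltr_wpDl ?mulr_ge0.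
  have d0 : 0 < `|e i| * `|y i| / (2 * K + 1) by rewrite divr_gt0.
  move/cvgr0Pnorm_le/(_ _ d0) : Se => [N _ NP].
  have := NP (maxn N i.+1) (leq_maxl _ _).
  rewrite /series /= big_mkord => sn.
  have := @partial_coef_le y K e i (maxn N i.+1) (leq_maxr _ _) Ky.
  rewrite leNgt => /negP; apply.
  rewrite (le_lt_trans (ler_wpM2l _ sn)) ?mulr_ge0//.
  rewrite mulrCA gtr_pMr// ltr_pdivrMr// mul1r; lra.
have Sc : series (fun i => c i *: y i) @ \oo --> u.
  apply/cvgrPdist_le => e e0.
  have K20 : 0 < K * 2 + 1 by rewrite ltr_wpDl ?mulr_ge0.
  have e20 : 0 < e / (K * 2 + 1) by rewrite divr_gt0.
  have [j _ /(_ j (leqnn _)) /= je] := near_infty_natSinv_lt (PosNum e20).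
  exists (dN j).2 => // m /= jm; rewrite distrC /series /= big_mkord -/(S c m).
  rewrite (le_trans (ler_distD (S (d j) m) _ _))//.
  rewrite (le_trans (lerD (cS _ _) (dNP j m jm)))//.
  rewrite mulrA -[X in _ + X]mul1r -mulrDl mulrC -ler_pdivlMr//.
  exact: ltW.
exists c; split=> // c' Sc'.
apply/eqP; rewrite -subr_eq0; apply/eqP; apply: uniq0.
rewrite -(subrr u); apply: cvg_trans (cvgB Sc Sc'); apply: near_eq_cvg.
apply: nearW => n; rewrite /series /= !fctE -sumrB.
by apply: eq_bigr => i _; rewrite -scalerBl.
Qed.

End basic_sequences.

(** * The sequence space of a monotone norm on finite sequences *)

(** Norms on the span of the first n unit vectors, compatible for varying n; the
    last two fields make the coordinates continuous and bound the norm. *)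
Record monotone_norm (R : realType) := MonotoneNorm {
  mnorm :> nat -> (nat -> R) -> R ;
  mnormD : forall n a b, mnorm n (a + b) <= mnorm n a + mnorm n b ;
  mnormZ : forall n (c : R) a, mnorm n (c *: a) = `|c| * mnorm n a ;
  mnormS : forall n a, mnorm n a <= mnorm n.+1 a ;
  mnorm_pad : forall n a, a n = 0 -> mnorm n.+1 a <= mnorm n a ;
  mnorm_coef : forall n a i, (i < n)%N -> `|a i| <= 2 * mnorm n a ;
  mnorm_ub : forall n a, mnorm n a <= \sum_(i < n) `|a i| }.

Definition mnorm_bounded (R : realType) (N : monotone_norm R) : pred (nat -> R) :=
  fun a => `[< exists M : R, forall n, N n a <= M >].

(** Sequences with bounded norms of initial segments: the space is complete, and
    as the norm is monotone it contains the finite sequences isometrically, so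
    that no completion has to be formed. *)
Record bseq (R : realType) (N : monotone_norm R) :=
  Bseq { bval : nat -> R ; bvalP : mnorm_bounded N bval }.

Section bseq_normed.
Context {R : realType} (N : monotone_norm R).

HB.instance Definition _ := [isSub for (@bval R N)].
HB.instance Definition _ := [Choice of bseq N by <:].

Fact mnorm_bounded_submod : submod_closed (mnorm_bounded N).
Proof.
split=> [|c a b /asboolP[A NA] /asboolP[B NB]]; apply/asboolP.
  exists 0 => n; have := mnormZ N n 0 0.
  by rewrite scale0r normr0 mul0r => ->.
exists (`|c| * A + B) => n; rewrite (le_trans (mnormD _ _ _ _))// mnormZ.
by rewrite lerD// ler_wpM2l.
Qed.

HB.instance Definition _ :=
  GRing.isSubmodClosed.Build R (nat -> R) (mnorm_bounded N) mnorm_bounded_submod.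
HB.instance Definition _ := [SubChoice_isSubLmodule of bseq N by <:].

Lemma bvalD (a b : bseq N) : bval (a + b) = bval a + bval b.
Proof. by []. Qed.

Lemma bvalB (a b : bseq N) : bval (a - b) = bval a - bval b.
Proof. by []. Qed.

Lemma bvalZ c (a : bseq N) : bval (c *: a) = c *: bval a.
Proof. by []. Qed.

Definition bnorm (a : bseq N) : R := sup (range (fun n => N n (bval a))).

Lemma bnorm_has_sup (a : bseq N) : has_sup (range (fun n => N n (bval a))).
Proof.
split; first by exists (N 0%N (bval a)), 0%N.
by have /asboolP[M NM] := bvalP a; exists M => _ [n _ <-].
Qed.

Lemma le_bnorm (a : bseq N) n : N n (bval a) <= bnorm a.
Proof. by apply: (sup_upper_bound (bnorm_has_sup a)); exists n. Qed.

Lemma bnorm_le (a : bseq N) M : (forall n, N n (bval a) <= M) -> bnorm a <= M.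
Proof.
by move=> aM; apply: ge_sup; [exact: (bnorm_has_sup a).1|move=> _ [n _ <-]].
Qed.

Let bnormD (a b : bseq N) : bnorm (a + b) <= bnorm a + bnorm b.
Proof.
by apply: bnorm_le => n; rewrite (le_trans (mnormD _ _ _ _))// lerD ?le_bnorm.
Qed.

Let bnormZ_le (c : R) (a : bseq N) : bnorm (c *: a) <= `|c| * bnorm a.
Proof. by apply: bnorm_le => n; rewrite mnormZ ler_wpM2l ?le_bnorm. Qed.

Let bnormZ (c : R) (a : bseq N) : bnorm (c *: a) = `|c| * bnorm a.
Proof.
apply/eqP; rewrite eq_le bnormZ_le /=.
have [->|c0] := eqVneq c 0.
  rewrite normr0 mul0r scale0r.
  by have := bnormD 0 0; rewrite addr0 -subr_ge0 addrK.
have := bnormZ_le c^-1 (c *: a); rewrite scalerA mulVf// scale1r normfV.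
by rewrite mulrC ler_pdivlMr ?normr_gt0// mulrC.
Qed.

Let bnorm_eq0 (a : bseq N) : bnorm a = 0 -> a = 0.
Proof.
move=> a0; apply: val_inj; apply/funext => i; apply/eqP.
rewrite -normr_le0 (le_trans (mnorm_coef N _ (ltnSn i)))//.
by rewrite pmulr_rle0// -a0 le_bnorm.
Qed.

HB.instance Definition _ := Lmodule_isNormed.Build R (bseq N)
  bnormD bnormZ bnorm_eq0.

Lemma bseq_normE (a : bseq N) : `|a| = bnorm a.
Proof. by []. Qed.

Lemma bval_le (a b : bseq N) i : `|bval a i - bval b i| <= 2 * `|a - b|.
Proof.
rewrite bseq_normE (le_trans _ (ler_wpM2l _ (le_bnorm (a - b) i.+1)))//.
exact: (mnorm_coef N (bval (a - b))).
Qed.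

(** A Cauchy filter converges coordinatewise, and the limit is also its limit in
    norm, the balls being closed under coordinatewise limits. *)
Lemma bseq_complete (F : set_system (bseq N)) : ProperFilter F -> cauchy F -> cvg F.
Proof.
move=> FF /(cauchyP F) cF.
have {}cF (e : R) : 0 < e -> exists a, F [set b | `|a - b| < e].
  by move=> /cF[a]; rewrite -ball_normE; exists a.
have cF2 i : exists l : R, (fun a : bseq N => bval a i) @ F --> l.
  apply/cvg_ex; apply: R_complete; apply: cauchy_exP => e e0.
  have e20 : 0 < e / 2 by rewrite divr_gt0.
  have [a Fa] := cF _ e20; exists (bval a i); rewrite -ball_normE.
  suff : F [set b | `|bval a i - bval b i| < e] by [].
  apply: filterS Fa => b /= ab; rewrite (le_lt_trans (bval_le _ _ _))//.
  by rewrite mulrC -ltr_pdivlMr.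
have [l lP] := choice cF2.
have Fl n e : 0 < e -> F [set b | \sum_(i < n) `|(bval b - l) i| <= e].
  elim: n e => [|n IH] e e0.
    by apply: filterE => b /=; rewrite big_ord0 ltW.
  have e20 : 0 < e / 2 by rewrite divr_gt0.
  have /cvgrPdist_le/(_ _ e20) := lP n.
  apply: filterS2 (IH _ e20) => b /= h1 h2.
  by rewrite big_ord_recr /= !fctE distrC [leRHS]splitr lerD.
have key e a n : 0 < e -> F [set b | `|a - b| < e] -> N n (bval a - l) <= e.
  move=> e0 Fa; apply/ler_addgt0Pr => d d0.
  have [b [/= ab bl]] := filter_ex (filterI Fa (Fl n d d0)).
  have -> : bval a - l = bval (a - b) + (bval b - l) by rewrite bvalB addrA subrK.
  rewrite (le_trans (mnormD _ _ _ _))// lerD//.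
    by rewrite (le_trans (le_bnorm _ _))// ltW.
  by rewrite (le_trans (mnorm_ub _ _ _)).
have keyN e a n : 0 < e -> F [set b | `|a - b| < e] -> N n (l - bval a) <= e.
  by move=> e0 /(key e a n e0); rewrite -opprB -scaleN1r mnormZ normrN1 mul1r.
have lb : mnorm_bounded N l.
  have [a Fa] := cF 1 ltr01; apply/asboolP; exists (1 + `|a|) => n.
  rewrite -[l](subrK (bval a)) (le_trans (mnormD _ _ _ _))// lerD ?le_bnorm//.
  exact: keyN.
apply/cvg_ex; exists (Bseq lb) => A /nbhs_ballP[e /= e0]; rewrite -ball_normE => sA.
have e20 : 0 < e / 2 by rewrite divr_gt0.
have [a Fa] := cF _ e20; apply: filterS (Fa) => b /= ab; apply: sA => /=.
rewrite (le_lt_trans (ler_distD a _ _))// [ltRHS]splitr ler_ltD//.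
apply: bnorm_le => n; exact: (keyN _ _ _ e20 Fa).
Qed.

HB.instance Definition _ := Uniform_isComplete.Build (bseq N) bseq_complete.

(** ** The unit vectors *)

Fact unit_bounded i : mnorm_bounded N (fun j => (j == i)%:R).
Proof.
apply/asboolP; exists 1 => n; rewrite (le_trans (mnorm_ub _ _ _))//.
have [iltn|nlei] := ltnP i n.
  rewrite (bigD1 (Ordinal iltn))//= eqxx normr1 big1 ?addr0// => j.
  by rewrite -val_eqE /= => /negbTE ->; rewrite normr0.
rewrite big1// => j _; rewrite ltn_eqF ?normr0//; exact: leq_trans nlei.
Qed.

Definition bunit i : bseq N := Bseq (unit_bounded i).

Lemma bval_sum n (a : nat -> R) j :
  bval (\sum_(i < n) a i *: bunit i) j = if (j < n)%N then a j else 0.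
Proof.
elim: n => [|n IH]; first by rewrite big_ord0.
rewrite big_ord_recr bvalD bvalZ fctE IH /= ltnS.
rewrite -[(_ *: _) _]/(a n * (j == n)%:R).
case: ltngtP => [jn|jn|->]; first by rewrite mulr0 addr0.
  by rewrite mulr0 addr0.
by rewrite mulr1 add0r.
Qed.

Lemma mnorm_leq (a : nat -> R) m n : (m <= n)%N -> N m a <= N n a.
Proof.
elim: n => [|n IH]; first by rewrite leqn0 => /eqP->.
rewrite leq_eqVlt => /orP[/eqP->//|/IH]/le_trans; apply; exact: mnormS.
Qed.

Lemma mnorm_ext n (a b : nat -> R) :
  (forall i, (i < n)%N -> a i = b i) -> N n a <= N n b.
Proof.
move=> ab; rewrite -[a](subrK b) (le_trans (mnormD _ _ _ _))//.
rewrite gerDr (le_trans (mnorm_ub _ _ _))// big1// => i _.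
by rewrite !fctE ab// subrr normr0.
Qed.

Lemma norm_bunit_sum n (a : nat -> R) : `|\sum_(i < n) a i *: bunit i| = N n a.
Proof.
rewrite bseq_normE; set u := \sum_(_ < _) _.
have ua i : (i < n)%N -> bval u i = a i by move=> iltn; rewrite bval_sum iltn.
apply/eqP; rewrite eq_le; apply/andP; split; last first.
  rewrite (le_trans _ (le_bnorm _ n))//; apply: mnorm_ext => i /ua ->.
  by [].
apply: bnorm_le => m; apply: (@le_trans _ _ (N n (bval u))); last exact: mnorm_ext.
have [/mnorm_leq//|] := leqP m n.
elim: m => [//|m IH]; rewrite ltnS leq_eqVlt => /orP[/eqP<-|nm].
  by apply: mnorm_pad; rewrite bval_sum ltnn.
apply: le_trans (IH nm); apply: mnorm_pad.
by rewrite bval_sum ltnNge (ltnW nm).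
Qed.

Lemma bunit_basic : basic_sequence bunit.
Proof.
apply: (@basic_sequence_grunblum _ _ _ 1) => // [i|c m n mn].
  apply/eqP => /(congr1 (fun u => bval u i)) /=; rewrite eqxx => /eqP.
  by rewrite oner_eq0.
by rewrite mul1r !norm_bunit_sum mnorm_leq.
Qed.

End bseq_normed.

(** * Finite nets of cubes *)

Lemma segment_net (R : realType) (C e : R) : 0 < e -> exists D : seq R,
  forall x, `|x| <= C -> exists2 d, d \in D & `|x - d| <= e.
Proof.
move=> e0; pose K := Num.bound `|2 * C / e|.
exists [seq - C + k%:R * e | k <- iota 0 K.+1] => x.
rewrite ler_norml => /andP[Cx xC]; pose q := (x + C) / e.
have q0 : 0 <= q by apply: divr_ge0 (ltW e0); lra.
have /andP[kq qk] := truncn_itv q0.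
exists (- C + (Num.truncn q)%:R * e).
  apply/mapP; exists (Num.truncn q) => //.
  rewrite mem_iota add0n /= ltnS -(ler_nat R) (le_trans kq)//.
  rewrite (@le_trans _ _ (2 * C / e))//.
    by rewrite ler_pM2r ?invr_gt0//; lra.
  by rewrite ltW// (le_lt_trans (ler_norm _))//; apply: archi_boundP.
have -> : x - (- C + (Num.truncn q)%:R * e) = (q - (Num.truncn q)%:R) * e.
  by rewrite mulrBl /q divfK ?gt_eqF// opprD opprK addrA.
rewrite normrM (gtr0_norm e0) ger_pMl// ger0_norm ?subr_ge0//.
by move: qk; rewrite -natr1; lra.
Qed.

Lemma cube_net (R : realType) (C e : R) n : 0 < e -> exists D : seq (nat -> R),
  forall a : nat -> R, (forall i, `|a i| <= C) ->
    exists2 d, d \in D & forall i, (i < n)%N -> `|a i - d i| <= e.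
Proof.
move=> e0; have [D1 D1P] := segment_net C e0.
elim: n => [|n [D DP]]; first by exists [:: 0] => a _; exists 0 => //; rewrite inE.
exists [seq (fun i => if i == n then x else d i) | d <- D, x <- D1] => a aC.
have [d dD ad] := DP a aC; have [x xD1 ax] := D1P _ (aC n).
exists (fun i => if i == n then x else d i).
  by apply/allpairsP; exists (d, x).
move=> i; rewrite ltnS leq_eqVlt; case: eqP => [->//|_ /=]; exact: ad.
Qed.

Lemma ultra_all (T : Type) (I : eqType) (G : ultra T) (D : seq I) (A : I -> set T) :
  (forall i, i \in D -> G (A i)) -> G [set u | forall i, i \in D -> A i u].
Proof.
elim: D => [|i D IH] GA; first by apply: filterE => u i.
have GD : G [set u | forall i, i \in D -> A i u].
  by apply: IH => j jD; apply: GA; rewrite inE jD orbT.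
apply: filterS2 (GA i (mem_head _ _)) GD => u Ai AD j.
by rewrite inE => /orP[/eqP->|/AD].
Qed.

(** * Sequences generated by an ultrafilter *)

Section generic_sequence.
Context {R : realType} {X : completeNormedModType R} (G : ultra X).
Hypothesis G1 : G [set y | `|y| = 1].

Let GB : G [set y | `|y| <= 1].
Proof. by apply: filterS G1 => y /= ->. Qed.

Let Gb : nbounded G.
Proof. by exists 1. Qed.

(** Interpolates between iterated limits (t = 0) and the norm of X (n = 0). *)
Definition mixed_norm (y : nat -> X) t n (a : nat -> R) : R :=
  iter_norm G (mkseq (fun j => a (t + j)%N) n) (\sum_(i < t) a i *: y i).

Lemma mixed_norm_lip y t n a b : (forall i, (i < t)%N -> `|y i| = 1) ->
  `|mixed_norm y t n a - mixed_norm y t n b| <= \sum_(i < t + n) `|a i - b i|.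
Proof.
move=> y1; rewrite /mixed_norm (le_trans (iter_norm_lip _ _ _ _ _ GB))//.
rewrite mul1r big_split_ord /= lerD2r -sumrB (le_trans (ler_norm_sum _ _ _))//.
by apply: ler_sum => i _; rewrite -scalerBl normrZ y1// mulr1.
Qed.

(** The norms are Lipschitz in the coefficients, so that it suffices to require
    the estimate for the finitely many coefficients of a net of the cube. *)
Lemma generic_step y t n (C e : R) : 0 < e -> (forall i, (i < t)%N -> `|y i| = 1) ->
  G [set u | forall a : nat -> R, (forall i, `|a i| <= C) ->
    `|iter_norm G (mkseq (fun j => a (t.+1 + j)%N) n)
        (\sum_(i < t) a i *: y i + a t *: u) - mixed_norm y t n.+1 a| <= e].
Proof.
move=> e0 y1; pose N := (t + n.+1)%N.
have d0 : 0 < e / 3 / N.+1%:R by rewrite divr_gt0 ?divr_gt0.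
have [D DP] := cube_net C N d0.
pose yu u i := if i == t then u else y i.
have mixedE u a : iter_norm G (mkseq (fun j => a (t.+1 + j)%N) n)
    (\sum_(i < t) a i *: y i + a t *: u) = mixed_norm (yu u) t.+1 n a.
  rewrite /mixed_norm big_ord_recr /= /yu eqxx; congr iter_norm.
  congr (_ + _); apply: eq_bigr => i _.
  by rewrite ltn_eqF.
have GD : G [set u | forall b, b \in D ->
    `|mixed_norm (yu u) t.+1 n b - mixed_norm y t n.+1 b| <= e / 3].
  apply: (@ultra_all _ _ _ _ (fun b =>
    [set u | `|mixed_norm (yu u) t.+1 n b - mixed_norm y t n.+1 b| <= e / 3])) => b _.
  have := ulimP (iter_norm_ubounded (mkseq (fun j => b (t.+1 + j)%N) n)
    (\sum_(i < t) b i *: y i) (b t) Gb) (_ : 0 < e / 3).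
  rewrite divr_gt0// => /(_ isT); apply: filterS => u /=; rewrite -mixedE.
  rewrite /mixed_norm mkseq_cons /= /shift addn0.
  have -> : mkseq ((fun j => b (t + j)%N) \o S) n = mkseq (fun j => b (t.+1 + j)%N) n.
    by apply: eq_mkseq => j /=; rewrite addnS.
  by [].
apply: filterS2 G1 GD => u /= u1 uD a aC; rewrite mixedE.
have [b bD ab] := DP a aC.
have sum_ab : \sum_(i < N) `|a i - b i| <= e / 3.
  apply: (@le_trans _ _ (\sum_(i < N) e / 3 / N.+1%:R)).
    by apply: ler_sum => i _; exact: ab.
  rewrite sumr_const card_ord -[leLHS]mulr_natr mulrAC ler_pdivrMr//.
  by rewrite ler_wpM2l ?ler_nat// ltW// divr_gt0.
have y1' i : (i < t.+1)%N -> `|yu u i| = 1.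
  by rewrite /yu ltnS leq_eqVlt; case: eqP => [//|_ /=]; exact: y1.
have h1 := @mixed_norm_lip (yu u) t.+1 n a b y1'.
have h2 := @mixed_norm_lip y t n.+1 b a y1.
rewrite addSnnS -/N in h1; rewrite -/N in h2.
have h3 := uD b bD.
have sum_ba : \sum_(i < N) `|b i - a i| <= e / 3.
  by under eq_bigr do rewrite distrC.
rewrite (le_trans (ler_distD (mixed_norm (yu u) t.+1 n b) _ _))//.
have -> : e = e / 3 + (e / 3 + e / 3) by lra.
rewrite lerD ?(le_trans h1)// (le_trans (ler_distD (mixed_norm y t n.+1 b) _ _))//.
by rewrite lerD// (le_trans h2).
Qed.

(** Each term has to meet finitely many conditions, all of which hold along G.
    The errors 2^-(t+2) are summable.  Allowing n <= t further vectors is enough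
    for spreading models, where n vectors have indices at least n - 1; the cube of
    side 4 accommodates the coordinates of unit vectors, the partial sum
    projections having norm at most 2. *)
Lemma generic_sequence_exists : exists y : nat -> X, (forall i, `|y i| = 1) /\
  forall t n (a : nat -> R), (n <= t)%N -> (forall i, `|a i| <= 4) ->
    `|iter_norm G (mkseq (fun j => a (t.+1 + j)%N) n)
        (\sum_(i < t) a i *: y i + a t *: y t) - mixed_norm y t n.+1 a|
    <= 2^-1 ^+ t.+2.
Proof.
pose good (ys : seq X) (u : X) := `|u| = 1 /\
  forall n (a : nat -> R), (n <= size ys)%N -> (forall i, `|a i| <= 4) ->
    `|iter_norm G (mkseq (fun j => a ((size ys).+1 + j)%N) n)
        (\sum_(i < size ys) a i *: nth 0 ys i + a (size ys) *: u)
      - mixed_norm (nth 0 ys) (size ys) n.+1 a| <= 2^-1 ^+ (size ys).+2.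
have goodP (ys : seq X) : exists u : X, (forall x, x \in ys -> `|x| = 1) -> good ys u.
  have [ys1|] := pselect (forall x, x \in ys -> `|x| = 1); last by exists 0.
  have y1 i : (i < size ys)%N -> `|nth 0 ys i| = 1.
    by move=> ilt; apply: ys1; exact: mem_nth.
  have e0 : 0 < 2^-1 ^+ (size ys).+2 :> R by rewrite exprn_gt0.
  have GA := @ultra_all _ _ G (iota 0 (size ys).+1) _
    (fun n _ => @generic_step (nth 0 ys) (size ys) n 4 _ e0 y1).
  have [u [u1 uP]] := ultra_ex2 G1 GA; exists u => _; split=> // n a nt aC.
  by apply: uP => //; rewrite mem_iota add0n ltnS.
have [pick pickP] := choice goodP.
pose pre := fix pre n := if n is m.+1 then rcons (pre m) (pick (pre m)) else [::].
have pre1 n : forall x, x \in pre n -> `|x| = 1.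
  elim: n => [//|n IH] x /=; rewrite mem_rcons inE => /orP[/eqP->|]; last exact: IH.
  by have [] := pickP _ IH.
have preE n : pre n = mkseq (fun i => pick (pre i)) n.
  by elim: n => // n IH; rewrite mkseqS -IH.
have spre n : size (pre n) = n by rewrite preE size_mkseq.
exists (fun i => pick (pre i)); split=> [i|t n a nt aC].
  by have [] := pickP _ (pre1 i).
have [_] := pickP _ (pre1 t); rewrite spre => /(_ n a nt aC).
have nthE i : (i < t)%N -> nth 0 (pre t) i = pick (pre i).
  by move=> it; rewrite {1}preE nth_mkseq.
rewrite /mixed_norm (eq_bigr (fun i : 'I_t => a i *: pick (pre i)))// => i _.
by rewrite nthE.
Qed.

End generic_sequence.

(** * Spreading models generated by ultrafilters *)

Section sum_norms.
Context {R : realType}.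
Implicit Types V W : normedModType R.

Definition sum_norm V (x : V ^nat) (s : seq R) : R :=
  `|\sum_(i < size s) s`_i *: x i|.

Lemma nth_map_ord (T : Type) (d : T) n (a : 'I_n -> T) (i : 'I_n) :
  nth d [seq a j | j <- enum 'I_n] i = a i.
Proof. by rewrite (nth_map i) ?size_enum_ord// nth_ord_enum. Qed.

Lemma sum_norm_ord V (x : V ^nat) n (a : 'I_n -> R) :
  `|\sum_(i < n) a i *: x i| = sum_norm x [seq a i | i <- enum 'I_n].
Proof.
rewrite /sum_norm size_map size_enum_ord.
by under [in RHS]eq_bigr do rewrite nth_map_ord.
Qed.

Lemma dominates_withP V W (x : V ^nat) (y : W ^nat) (C : R) :
  dominates_with C x y <-> forall s, sum_norm y s <= C * sum_norm x s.
Proof.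
split=> [xy s|xy n a]; first exact: (xy (size s) (fun i => s`_i)).
by rewrite !sum_norm_ord.
Qed.

Lemma sum_norm_ge0 V (x : V ^nat) s : 0 <= sum_norm x s.
Proof. exact: normr_ge0. Qed.

End sum_norms.

Section generated_sequence.
Context {R : realType} {X : completeNormedModType R} (G : ultra X).
Hypothesis G1 : G [set y | `|y| = 1].
Hypothesis G0 : null_ultra G.

Let GB : G [set y | `|y| <= 1].
Proof. by apply: filterS G1 => y /= ->. Qed.

Let Gb : nbounded G.
Proof. by exists 1. Qed.

Lemma null_norm_le_iter_norm s v : `|v| <= iter_norm G s v.
Proof.
elim: s => [//|a s IH]; apply: (le_trans IH).
exact: null_iter_norm_cons.
Qed.

(** Suppress the coordinates before and after i. *)
Lemma null_iter_norm_coef n (a : nat -> R) i : (i < n)%N ->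
  `|a i| <= iter_norm G (mkseq a n) 0.
Proof.
elim: n a i => // n IH a [_|i]; last first.
  rewrite mkseq_cons ltnS => /(IH (a \o S))/le_trans; apply.
  exact: null_iter_norm_cons.
rewrite mkseq_cons; apply: ulim_ge_cst; first exact: iter_norm_ubounded.
apply: filterS G1 => y /= y1; apply: le_trans (null_norm_le_iter_norm _ _).
by rewrite add0r normrZ y1 mulr1.
Qed.

Fact ultra_normD n (a b : nat -> R) : iter_norm G (mkseq (a + b) n) 0 <=
  iter_norm G (mkseq a n) 0 + iter_norm G (mkseq b n) 0.
Proof. by rewrite -{1}[0]addr0; exact: iter_normD. Qed.

Fact ultra_normZ n c (a : nat -> R) :
  iter_norm G (mkseq (c *: a) n) 0 = `|c| * iter_norm G (mkseq a n) 0.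
Proof.
rewrite -(iter_normZ _ _ _ Gb) scaler0 /mkseq -map_comp.
by congr iter_norm; apply: eq_map.
Qed.

Let truncate n (a : nat -> R) : iter_norm G (mkseq a n) =
  iter_norm G (mkseq ((fun i => (i < n)%:R) \* a) n.+1).
Proof.
rewrite -(iter_norm_filter _ (mkseq a n)) -(iter_norm_filter _ (mkseq _ n.+1)).
have -> : mkseq ((fun i => (i < n)%:R) \* a) n.+1 = rcons (mkseq a n) 0.
  rewrite mkseqS /= ltnn mul0r; congr rcons.
  by apply/eq_in_map => i; rewrite mem_iota /= => ->; rewrite mul1r.
by rewrite filter_rcons eqxx.
Qed.

Fact ultra_normS n (a : nat -> R) :
  iter_norm G (mkseq a n) 0 <= iter_norm G (mkseq a n.+1) 0.
Proof.
rewrite truncate; apply: null_iter_norm_le => // i.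
by case: ltnP => _; rewrite ?lexx ?ler01.
Qed.

Fact ultra_norm_pad n (a : nat -> R) : a n = 0 ->
  iter_norm G (mkseq a n.+1) 0 <= iter_norm G (mkseq a n) 0.
Proof.
move=> an; rewrite -(iter_norm_filter _ (mkseq a n.+1)) mkseqS filter_rcons an eqxx.
by rewrite iter_norm_filter.
Qed.

Fact ultra_norm_coef n (a : nat -> R) i : (i < n)%N ->
  `|a i| <= 2 * iter_norm G (mkseq a n) 0.
Proof.
move=> /null_iter_norm_coef ai; rewrite (le_trans (ai a))//.
by rewrite ler_peMl ?iter_norm_ge0// ler1n.
Qed.

Fact ultra_norm_ub n (a : nat -> R) :
  iter_norm G (mkseq a n) 0 <= \sum_(i < n) `|a i|.
Proof.
rewrite (le_trans (iter_norm_ub _ _ GB))// normr0 add0r mul1r.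
by rewrite big_map -{1}[n]subn0 big_mkord.
Qed.

Definition ultra_norm : monotone_norm R := MonotoneNorm ultra_normD ultra_normZ
  ultra_normS ultra_norm_pad ultra_norm_coef ultra_norm_ub.

Lemma sum_norm_bunit s : sum_norm (bunit ultra_norm) s = iter_norm G s 0.
Proof. by rewrite /sum_norm norm_bunit_sum /= mkseq_nth. Qed.

Section sequence.
Variable y : nat -> X.
Hypothesis y1 : forall i, `|y i| = 1.
Hypothesis y_generic : forall t n (a : nat -> R), (n <= t)%N ->
  (forall i, `|a i| <= 4) ->
  `|iter_norm G (mkseq (fun j => a (t.+1 + j)%N) n)
      (\sum_(i < t) a i *: y i + a t *: y t) - mixed_norm G y t n.+1 a|
  <= 2^-1 ^+ t.+2.

Let cube_span t v := exists2 c : nat -> R,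
  forall i, `|c i| <= 4 & v = \sum_(i < t) c i *: y i.

Let cube_spanW t t' v : (t <= t')%N -> cube_span t v -> cube_span t' v.
Proof.
move=> tt' [c c4 ->]; exists (fun i => if (i < t)%N then c i else 0).
  by move=> i; case: ifP => // _; rewrite normr0.
rewrite -(subnKC tt') big_split_ord /= [X in _ + X]big1 ?addr0; last first.
  by move=> i _; rewrite ltnNge leq_addr scale0r.
by apply: eq_bigr => i _; rewrite ltn_ord.
Qed.

Let cube_spanS t v b : cube_span t v -> `|b| <= 4 -> cube_span t.+1 (v + b *: y t).
Proof.
move=> [c c4 ->] b4; exists (fun i => if (i < t)%N then c i else b).
  by move=> i; case: ifP.
rewrite big_ord_recr /= ltnn; congr (_ + _).
by apply: eq_bigr => i _; rewrite ltn_ord.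
Qed.

Let step t v b s : cube_span t v -> `|b| <= 4 -> (forall x, x \in s -> `|x| <= 4) ->
  (size s <= t)%N ->
  `|iter_norm G s (v + b *: y t) - iter_norm G (b :: s) v| <= 2^-1 ^+ t.+2.
Proof.
move=> [c c4 ->] b4 s4 st.
pose a i := if (i < t)%N then c i else nth 0 (b :: s) (i - t).
have a4 i : `|a i| <= 4.
  rewrite /a; case: ltnP => [_|ti]; first exact: c4.
  have [lt|ge] := ltnP (i - t) (size (b :: s)); last first.
    by rewrite nth_default// normr0.
  have := mem_nth 0 lt; set x := nth _ _ _; rewrite inE => /orP[/eqP->//|]; exact: s4.
have := y_generic st a4; rewrite /mixed_norm.
have -> : mkseq (fun j => a (t.+1 + j)%N) (size s) = s.
  rewrite -[RHS](mkseq_nth 0); apply: eq_mkseq => j.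
  by rewrite /a ltnNge addSnnS leq_addr /= addKn.
have -> : mkseq (fun j => a (t + j)%N) (size s).+1 = b :: s.
  rewrite -[RHS](mkseq_nth 0); apply: eq_mkseq => j.
  by rewrite /a ltnNge leq_addr /= addKn.
have -> : a t = b by rewrite /a ltnn subnn.
rewrite (eq_bigr (fun i : 'I_t => c i *: y i))// => i _.
by rewrite /a ltn_ord.
Qed.

Let tail_half t : 2^-1 ^+ t.+2 + 2^-1 ^+ t.+2 = 2^-1 ^+ t.+1 :> R.
Proof. by rewrite -mulr2n -[LHS]mulr_natl exprS mulrA divff// mul1r. Qed.

(** The errors made in replacing the generic vectors one by one by y k, k in ks,
    add up to the tail of a geometric series. *)
Lemma generic_spreading s ks v t : size s = size ks ->
  (forall x, x \in s -> `|x| <= 4) ->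
  (size s <= t.+1)%N -> all (leq t) ks -> sorted ltn ks -> cube_span t v ->
  `| `|v + \sum_(p <- zip s ks) p.1 *: y p.2| - iter_norm G s v| <= 2^-1 ^+ t.+1.
Proof.
elim: s ks v t => [|b s IH] [|k ks] v t //= sz s4 st.
  by move=> _ _ _; rewrite big_nil addr0 subrr normr0 exprn_ge0.
move=> /andP[tk _] kks vt; rewrite big_cons /= addrA.
have b4 : `|b| <= 4 by apply: s4; rewrite mem_head.
have {}s4 x : x \in s -> `|x| <= 4 by move=> xs; apply: s4; rewrite inE xs orbT.
have sk : (size s <= k)%N by exact: leq_trans tk.
have vk := cube_spanW tk vt.
have vk1 := cube_spanS vk b4.
have h1 := step vk b4 s4 sk.
have h2 : `| `|v + b *: y k + \sum_(p <- zip s ks) p.1 *: y p.2| -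
    iter_norm G s (v + b *: y k)| <= 2^-1 ^+ k.+2.
  apply: IH => //; first by case: sz.
  - by rewrite (leq_trans sk)// leqW.
  - exact: order_path_min ltn_trans kks.
  - exact: path_sorted kks.
rewrite (le_trans (ler_distD (iter_norm G s (v + b *: y k)) _ _))//.
rewrite (le_trans (lerD h2 h1))// tail_half.
by rewrite ler_wiXn2l// ?invr_ge0// invf_le1// ler1n.
Qed.

(** The factors 1 - 2^-(i+2) lost at each step multiply to at least 1/2: the
    sequence 1/2 + 2^-(i+1) records the product. *)
Lemma generic_partial_sums (c : nat -> R) m n : (m <= n)%N ->
  `|\sum_(i < m) c i *: y i| <= 2 * `|\sum_(i < n) c i *: y i|.
Proof.
pose S (c : nat -> R) n := \sum_(i < n) c i *: y i.
pose rho n : R := 2^-1 + 2^-1 ^+ n.+1.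
have rho_gt n' : 2^-1 < rho n' by rewrite ltrDl exprn_gt0.
have rho_le n' : rho n' <= 1.
  have -> : 1 = 2^-1 + 2^-1 ^+ 1 :> R by lra.
  by rewrite lerD2l ler_wiXn2l// ?invr_ge0// invf_le1// ler1n.
suff key c' m' n' : (m' <= n')%N -> rho n' * `|S c' m'| <= rho m' * `|S c' n'|.
  move=> mn; have := key c m n mn; rewrite -/(S c m) -/(S c n).
  have := rho_gt n; have := rho_le m; have := normr_ge0 (S c m).
  have := normr_ge0 (S c n); nra.
elim: n' c' m' => [|n' IH] c' m'; first by rewrite leqn0 => /eqP->.
rewrite leq_eqVlt => /orP[/eqP->//|]; rewrite ltnS => mn.
have Sstep : (1 - 2^-1 ^+ n'.+2) * `|S c' n'| <= `|S c' n'.+1|.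
  have [S0|S0] := eqVneq `|S c' n'| 0.
    by rewrite S0 mulr0 normr_ge0.
  have Sp : 0 < `|S c' n'| by rewrite lt_neqAle eq_sym S0 normr_ge0.
  have dlt1 : 2^-1 ^+ n'.+2 <= 1 :> R by rewrite exprn_ile1// ?invr_ge0// invf_le1// ler1n.
  have dge0 : 0 <= 2^-1 ^+ n'.+2 :> R by rewrite exprn_ge0.
  (* after scaling the partial sum to norm one, its coefficients are at most 4 *)
  pose r := `|S c' n'|; pose d i := r^-1 * c' i.
  have Sd k : S d k = r^-1 *: S c' k.
    by rewrite /S scaler_sumr; apply: eq_bigr => i _; rewrite scalerA.
  have Sdn : `|S d n'| = 1 by rewrite Sd normrZ normfV normr_id mulVf.
  have d4 i : (i < n')%N -> `|d i| <= 4.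
    move=> ilt; have := partial_coef y d i; rewrite -!/(S _ _) => e1.
    have : `|d i *: y i| <= `|S d i.+1| + `|S d i| by rewrite e1; exact: ler_normB.
    rewrite normrZ y1 mulr1.
    have := IH d i (ltnW ilt); have := IH d i.+1 ilt; rewrite Sdn !mulr1.
    have := rho_gt n'; have := rho_le i; have := rho_le i.+1.
    have := normr_ge0 (S d i); have := normr_ge0 (S d i.+1); nra.
  suff : 1 - 2^-1 ^+ n'.+2 <= `|S d n'.+1|.
    by rewrite Sd normrZ normfV normr_id mulrC ler_pdivlMr.
  have -> : S d n'.+1 = S d n' + d n' *: y n' by rewrite /S big_ord_recr.
  have [dn4|dn4] := lerP `|d n'| 4; last first.
    rewrite [S d n' + _]addrC; have := lerB_normD (d n' *: y n') (S d n').
    by rewrite normrZ y1 mulr1 Sdn; lra.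
  have span : cube_span n' (S d n').
    exists (fun i => if (i < n')%N then d i else 0).
      by move=> i; case: ifP => [/d4//|_]; rewrite normr0.
    by apply: eq_bigr => i _; rewrite ltn_ord.
  have nil4 (x : R) : x \in [::] -> `|x| <= 4 by [].
  have := step span dn4 nil4 isT.
  have := null_norm_le_iter_norm [:: d n'] (S d n'); rewrite Sdn => h1.
  rewrite [iter_norm G [::] _]/= ler_norml => /andP[h2 _]; lra.
have := IH c' m' mn.
have -> : rho n'.+1 = rho n' - 2^-1 ^+ n'.+2 by rewrite /rho -(tail_half n'); lra.
have := rho_le n'; have := rho_gt n'; have := rho_le m'; have := rho_gt m'.
have := normr_ge0 (S c' m'); have := normr_ge0 (S c' n').
have d0 : 0 < 2^-1 ^+ n'.+2 :> R by rewrite exprn_gt0.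
set A := `|S c' m'|; set B := `|S c' n'| in Sstep *; set C := `|S c' n'.+1| in Sstep *.
set e := 2^-1 ^+ n'.+2 in Sstep d0 *; set x := rho n'; set z := rho m'.
move=> B0 A0 z1 z2 x1 x2 xz.
have e1 : e <= 1 by rewrite exprn_ile1// ?invr_ge0// invf_le1// ler1n.
apply: (@le_trans _ _ ((1 - e) * (x * A))).
  by rewrite mulrA ler_wpM2r//; nra.
apply: (@le_trans _ _ ((1 - e) * (z * B))); first by rewrite ler_wpM2l// subr_ge0.
by rewrite mulrCA ler_wpM2l//; lra.
Qed.

Lemma generic_basic : basic_sequence y.
Proof.
apply: (@basic_sequence_grunblum _ _ _ 2) => //; last exact: generic_partial_sums.
by move=> i; rewrite -normr_gt0 y1.
Qed.

Lemma generic_has_spreading_model : has_spreading_model y (bunit ultra_norm).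
Proof.
split; [|exact: bunit_basic|].
  by exists 1, 1; split=> // i; rewrite y1 lexx.
exists (fun n => 2 * 2^-1 ^+ n); split.
- move=> m n mn; rewrite ler_wpM2l// ler_wiXn2l// ?invr_ge0//.
  by rewrite invf_le1// ler1n.
- rewrite -(mulr0 2); apply: cvgMr; apply: cvg_expr.
  by rewrite ger0_norm ?invr_ge0// invf_lt1// ltr1n.
move=> n n0 a k a1 kn kmono.
pose s := [seq a i | i <- enum 'I_n]; pose ks := [seq k i | i <- enum 'I_n].
have ss : size s = n by rewrite size_map size_enum_ord.
have sks : size s = size ks by rewrite !size_map.
have s4 x : x \in s -> `|x| <= 4.
  move=> /mapP[i _ ->]; have := a1 i; rewrite -ler_norml => ?.
  by rewrite (@le_trans _ _ 1)// ler1n.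
have st : (size s <= n.-1.+1)%N by rewrite ss prednK.
have kst : all (leq n.-1) ks.
  by apply/allP => _ /mapP[i _ ->]; have := kn i; case: (n) n0.
have kss : sorted ltn ks.
  rewrite sorted_map; have := iota_ltn_sorted 0 n; rewrite -val_enum_ord sorted_map.
  by apply: sub_sorted => i j; exact: kmono.
have span0 : cube_span n.-1 0.
  exists (fun=> 0); first by move=> i; rewrite normr0.
  by rewrite big1// => i _; rewrite scale0r.
have := generic_spreading sks s4 st kst kss span0.
have -> : 0 + \sum_(p <- zip s ks) p.1 *: y p.2 = \sum_(i < n) a i *: y (k i).
  by rewrite add0r zip_map big_map big_enum.
rewrite sum_norm_ord -/s sum_norm_bunit prednK//.
move=> /le_lt_trans; apply.
by rewrite ltr_pMl// ?ltr1n// exprn_gt0.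
Qed.

End sequence.
End generated_sequence.

Section realization.
Context {R : realType} {X : completeNormedModType R}.
Implicit Types G : ultra X.

Lemma realize_normalized_ultra G : G [set y | `|y| = 1] -> null_ultra G ->
  exists (E : completeNormedModType R) (xt : E ^nat),
    spreading_model_in X xt /\ forall s, sum_norm xt s = iter_norm G s 0.
Proof.
move=> G1 G0; exists (bseq (ultra_norm G1 G0)), (bunit _); split; last first.
  exact: sum_norm_bunit.
have [y [y1 yg]] := generic_sequence_exists G1.
exists y; split; last exact: (generic_has_spreading_model G1 G0 y1 yg).
by split=> //; exact: (generic_basic G1 G0 y1 yg).
Qed.

Lemma ulim_close T (G : ultra T) (f g h : T -> R) (C : R) :
  ubounded G f -> ubounded G h -> 0 <= C ->
  G [set y | `|f y - g y| <= C * `|h y - ulim G h|] -> ulim G g = ulim G f.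
Proof.
move=> fb hb C0 fg; apply: ulim_unique => e e0.
have e20 : 0 < e / 2 by rewrite divr_gt0.
have d0 : 0 < e / 2 / (C + 1) by rewrite divr_gt0// ltr_wpDl.
apply: filterS3 (ulimP fb e20) (ulimP hb d0) fg => y /= h1 h2 h3.
rewrite (le_trans (ler_distD (f y) _ _))// [leRHS]splitr lerD// distrC.
rewrite (le_trans h3)// (le_trans (ler_wpM2l C0 h2))//.
by rewrite mulrCA ger_pMr// ler_pdivrMr ?mul1r ?lerDl// ltr_wpDl.
Qed.

(** Normalizing generic vectors amounts to dividing them by the limit of their
    norms. *)
Lemma realize_ultra G : nbounded G -> null_ultra G -> 0 < ulim G (fun y => `|y|) ->
  exists (E : completeNormedModType R) (xt : E ^nat), spreading_model_in X xt /\
    forall s, sum_norm xt s = iter_norm G s 0 / ulim G (fun y => `|y|).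
Proof.
set r := ulim G _ => Gb G0 r0.
have nb : ubounded G (fun y => `|y|).
  exact: convex_lip_ubounded Gb convex_lip_norm.
pose G' := ultra_map (fun y => `|y|^-1 *: y) G.
have shiftE a f : convex_lip f -> shift G' a f = shift G (a / r) f.
  move=> fcl; apply/funext => v; rewrite /shift ulim_map.
  have [_ [L L0 fL]] := fcl.
  apply: (@ulim_close _ _ _ _ (fun y => `|y|) (L * (`|a| / r))) => //.
  - exact: shift_ubounded.
  - by rewrite !mulr_ge0// invr_ge0 ltW.
  have r20 : 0 < r / 2 by rewrite divr_gt0.
  apply: filterS (ulimP nb r20) => u /=; rewrite -/r => ur.
  have u0 : 0 < `|u| by move: ur; rewrite ler_norml => /andP[]; lra.
  rewrite (le_trans (fL _ _))// -mulrA ler_wpM2l//.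
  rewrite opprD addrACA subrr add0r scalerA -scalerBl normrZ.
  have -> : a / r - a / `|u| = a / r * ((`|u| - r) / `|u|).
    by field; rewrite !gt_eqF.
  by rewrite !normrM !normfV normr_id -!mulrA mulVf ?gt_eqF// mulr1 (gtr0_norm r0).
have G'1 : G' [set y | `|y| = 1].
  have r20 : 0 < r / 2 by rewrite divr_gt0.
  rewrite /= ; apply: filterS (ulimP nb r20) => u /=; rewrite -/r => ur.
  have u0 : 0 < `|u| by move: ur; rewrite ler_norml => /andP[]; lra.
  by rewrite normrZ normfV normr_id mulVf ?gt_eqF.
have G'0 : null_ultra G'.
  move=> f fcl; have /(congr1 (@^~ 0)) := shiftE 1 _ fcl.
  have := null_shift (1 / r) 0 G0 fcl => /[swap] <- /le_trans; apply.
  by rewrite /shift; under eq_ulim do rewrite add0r scale1r.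
have [E [xt [smxt xtE]]] := realize_normalized_ultra G'1 G'0.
exists E, xt; split=> // s; rewrite xtE mulrC -[X in X * _]gtr0_norm ?invr_gt0//.
rewrite -(iter_normZ _ _ _ Gb) scaler0; congr (_ _).
elim: s => //= a s ->; rewrite shiftE ?[_ / _]mulrC//.
exact: convex_lip_iter_norm.
Qed.

End realization.

(** ** The ultrafilter of a sequence *)

Section ultra_of_sequence.
Context {R : realType} {X : completeNormedModType R}.

Lemma sum_ord_pad (V : zmodType) n m (F : nat -> V) : (n <= m)%N ->
  (forall i, (n <= i)%N -> F i = 0) -> \sum_(i < m) F i = \sum_(i < n) F i.
Proof.
move=> nm F0; rewrite -(subnKC nm) big_split_ord /= [X in _ + X]big1 ?addr0// => i _.
by rewrite F0// leq_addr.
Qed.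

Lemma sum_zip (s : seq R) ks (x : nat -> X) : size s = size ks ->
  \sum_(p <- zip s ks) p.1 *: x p.2 = \sum_(i < size s) s`_i *: x (nth 0%N ks i).
Proof.
move=> sk; rewrite (big_nth (0, 0%N)) size_zip -sk minnn big_mkord.
by apply: eq_bigr => i _; rewrite nth_zip.
Qed.

(** Padding with zero coefficients makes the error term as small as one likes
    for any fixed number of vectors. *)
Lemma spreading_model_close (E : completeNormedModType R) (x : X ^nat) (xt : E ^nat)
    (s : seq R) (e : R) :
  has_spreading_model x xt -> (forall a, a \in s -> `|a| <= 1) -> 0 < e ->
  exists m, forall ks, size s = size ks -> all (leq m) ks -> sorted ltn ks ->
    `| `|\sum_(p <- zip s ks) p.1 *: x p.2| - sum_norm xt s| <= e.
Proof.
move=> [_ _ [eps [eps_ni eps0 epsP]]] s1 e0.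
move/cvgr0Pnorm_le/(_ _ e0) : eps0 => [n0 _ n0P].
pose n := maxn (size s) n0.+1.
have sn : (size s <= n)%N by rewrite leq_maxl.
have n_gt0 : (0 < n)%N by rewrite leq_max orbT.
exists n => ks sk kn kinc.
pose k i := if (i < size ks)%N then nth 0%N ks i else (\max_(j <- ks) j + i + n).+1.
have k_ge i : (n <= (k i).+1)%N.
  rewrite /k; case: ltnP => [iks|_]; last by do 2 apply: leqW; exact: leq_addl.
  by rewrite (leq_trans (allP kn _ (mem_nth 0%N iks)))// leqnSn.
have k_inc i j : (i < j)%N -> (k i < k j)%N.
  move=> ij; rewrite /k; have [jks|jks] := ltnP j (size ks).
    rewrite (ltn_trans ij jks); apply: (sorted_ltn_nth ltn_trans) => //.
    by rewrite inE (ltn_trans ij jks).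
  case: (ltnP i (size ks)) => [iks|iks] /=.
    rewrite ltnS -addnA (leq_trans _ (leq_addr _ _))//.
    exact: (@leq_bigmax_seq _ _ xpredT id _ (mem_nth 0%N iks)).
  by rewrite ltnS ltn_add2r ltn_add2l.
have a1 (i : 'I_n) : -1 <= s`_i <= 1.
  rewrite -ler_norml; have [ilt|ige] := ltnP i (size s).
    by apply: s1; exact: mem_nth.
  by rewrite nth_default// normr0.
have := epsP n n_gt0 (fun i => s`_i) k a1 k_ge (fun i j => k_inc i j).
rewrite (sum_ord_pad (F := fun i => s`_i *: x (k i)) sn); last first.
  by move=> i si; rewrite nth_default// scale0r.
rewrite (sum_ord_pad (F := fun i => s`_i *: xt i) sn); last first.
  by move=> i si; rewrite nth_default// scale0r.
rewrite (eq_bigr (fun i : 'I_(size s) => s`_i *: x (nth 0%N ks i))); last first.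
  by move=> i _; rewrite /k -sk ltn_ord.
rewrite -(sum_zip _ sk) => /ltW/le_trans; apply.
have := n0P n; rewrite /= => /(_ _)/(le_trans (ler_norm _)); apply.
by rewrite (leq_trans (leqnSn _))// leq_maxr.
Qed.

Lemma sum_normZ (V : normedModType R) (x : V ^nat) c s :
  sum_norm x [seq c * a | a <- s] = `|c| * sum_norm x s.
Proof.
rewrite /sum_norm size_map -normrZ scaler_sumr; congr `|_|.
by apply: eq_bigr => i _; rewrite (nth_map 0)// scalerA.
Qed.

Lemma ultra_map_normalized (x : X ^nat) (U : ultra nat) : normalized x ->
  ultra_map x U [set y | `|y| = 1].
Proof. by move=> x1; rewrite /=; apply: filterE => k /=; exact: x1. Qed.

(** Along an ultrafilter on the indices, later limits may be taken over indices
    larger than the earlier ones, where the spreading model estimate applies. *)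
Lemma spreading_model_iter_norm (U : ultra nat) (E : completeNormedModType R)
    (x : X ^nat) (xt : E ^nat) s :
  (forall n, U [set k | (n <= k)%N]) -> normalized x -> has_spreading_model x xt ->
  iter_norm (ultra_map x U) s 0 = sum_norm xt s.
Proof.
move=> Unp x1 smx; set G := ultra_map x U.
have Gb : nbounded G.
  by exists 1; apply: filterS (ultra_map_normalized U x1) => y /= ->.
suff small (r : seq R) : (forall a, a \in r -> `|a| <= 1) ->
    iter_norm G r 0 = sum_norm xt r.
  pose c := 1 + \sum_(a <- s) `|a|.
  have c0 : 0 < c by rewrite ltr_pwDl// sumr_ge0.
  have sc : s = [seq c * a | a <- [seq c^-1 * b | b <- s]].
    by rewrite -map_comp map_id_in// => a _ /=; rewrite mulrA divff ?mul1r// gt_eqF.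
  rewrite sc sum_normZ -[in LHS](scaler0 _ c) iter_normZ// small// => _ /mapP[a sa ->].
  rewrite normrM normfV (gtr0_norm c0) mulrC ler_pdivrMr// mul1r /c.
  rewrite (big_rem a)//= addrCA lerDl addr_ge0// sumr_ge0//.
move=> r1; apply/eqP; rewrite -subr_eq0 -normr_le0; apply/ler_addgt0Pr => e e0.
rewrite add0r; have [m mP] := spreading_model_close smx r1 e0.
suff key r2 s1 k1 : s1 ++ r2 = r -> size s1 = size k1 -> all (leq m) k1 ->
    sorted ltn k1 ->
    `|iter_norm G r2 (\sum_(p <- zip s1 k1) p.1 *: x p.2) - sum_norm xt r| <= e.
  by have := key r [::] [::] erefl erefl isT isT; rewrite big_nil.
elim: r2 s1 k1 => [|b r2 IH] s1 k1.
  by rewrite cats0 => -> sk km kinc; exact: mP.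
move=> sr sk km kinc /=.
set v := \sum_(_ <- _) _; set c := sum_norm xt r.
have near_c : U [set k | `|iter_norm G r2 (v + b *: x k) - c| <= e].
  apply: filterS (Unp (maxn m (\max_(j <- k1) j).+1)) => k /=.
  rewrite geq_max => /andP[mk k1k].
  have := IH (rcons s1 b) (rcons k1 k).
  rewrite zip_rcons// -[rcons (zip _ _) _]cats1 big_cat big_seq1 cat_rcons.
  apply => //; first by rewrite !size_rcons sk.
  - by rewrite all_rcons mk.
  - rewrite (sorted_pairwise ltn_trans) pairwise_rcons.
    rewrite -(sorted_pairwise ltn_trans) kinc andbT.
    apply/allP => j jk; rewrite (leq_ltn_trans _ k1k)//.
    exact: (@leq_bigmax_seq _ _ xpredT id).
have ub := iter_norm_ubounded r2 v b Gb.
rewrite ler_norml; apply/andP; split.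
  rewrite lerBrDl; apply: ulim_ge_cst => //; apply: filterS near_c => k /=.
  by rewrite ler_norml => /andP[h _]; lra.
rewrite lerBlDl; apply: ulim_le_cst => //; apply: filterS near_c => k /=.
by rewrite ler_norml => /andP[_ h]; lra.
Qed.

End ultra_of_sequence.

(** * The alternative between l_1 and null ultrafilters *)

Definition unique_spreading_model (R : realType) (X : completeNormedModType R) : Prop :=
  forall (E F : completeNormedModType R) (xt : E ^nat) (yt : F ^nat),
    spreading_model_in X xt -> spreading_model_in X yt -> equivalent xt yt.

Section ultra_of_spreading_model.
Context {R : realType} {X : completeNormedModType R}.
Implicit Types (G : ultra X) (E : completeNormedModType R) (s : seq R).

(** The norm of the spreading model as the iterated limits along G; the sequence in
    X that produced G is forgotten. *)
Definition generates G E (xt : E ^nat) : Prop :=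
  G [set y | `|y| = 1] /\ forall s, iter_norm G s 0 = sum_norm xt s.

Lemma generates_nbounded G E (xt : E ^nat) : generates G xt -> nbounded G.
Proof. by move=> [G1 _]; exists 1; apply: filterS G1 => y /= ->. Qed.

Lemma spreading_model_ultra E (xt : E ^nat) : spreading_model_in X xt ->
  exists G, generates G xt.
Proof.
move=> [x [[x1 bx] smx]]; have [U Unp] := nonprincipal_ultra.
exists (ultra_map x U); split; first exact: ultra_map_normalized.
by move=> s; exact: spreading_model_iter_norm.
Qed.

Lemma spreading_model_basic E (xt : E ^nat) : spreading_model_in X xt ->
  basic_sequence xt.
Proof. by move=> [x [_ []]]. Qed.

(** Otherwise xt 0 would have two expansions. *)
Lemma basic_sequence_neq E (xt : E ^nat) : basic_sequence xt -> xt 0%N != xt 1%N.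
Proof.
move=> bx; apply/eqP => x01.
have [|c [_ cu]] := bx (xt 0%N).
  apply: subset_closure; exists 1%N, (fun=> 1).
  by rewrite big_ord1 scale1r.
have cj (j : nat) : (j < 2)%N -> c = (fun i => (i == j)%:R).
  move=> j2; apply: cu; apply: cvg_near_cst; exists 2%N => // n /= n2.
  have jn : (j < n)%N by exact: leq_trans n2.
  rewrite /series /= big_mkord (bigD1 (Ordinal jn))//= eqxx scale1r big1 ?addr0.
    by case: j j2 {jn} => [//|[|//]].
  by move=> i; rewrite -val_eqE /= => /negbTE->; rewrite scale0r.
have := cj 0%N isT; rewrite (cj 1%N isT) => /(congr1 (@^~ 0%N)) /= /eqP.
by rewrite eq_sym oner_eq0.
Qed.

Lemma spreading_model_le_l1 E (xt : E ^nat) s : spreading_model_in X xt ->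
  sum_norm xt s <= \sum_(a <- s) `|a|.
Proof.
move=> /spreading_model_ultra[G [G1 <-]].
have GB : G [set y | `|y| <= 1] by apply: filterS G1 => y /= ->.
by rewrite (le_trans (iter_norm_ub _ _ GB))// normr0 add0r mul1r.
Qed.

Lemma spreading_model_normalized E (xt : E ^nat) : spreading_model_in X xt ->
  normalized xt.
Proof.
move=> /spreading_model_ultra[G [G1 GE]] i.
have := GE (nseq i 0 ++ [:: 1]); rewrite iter_norm_nseq0 /=.
have -> : shift G 1 (fun v => `|v|) 0 = 1.
  apply: ulim_unique => e e0; apply: filterS G1 => y /=.
  by rewrite add0r scale1r => ->; rewrite subrr normr0 ltW.
rewrite /sum_norm size_cat size_nseq addn1 big_ord_recr /= nth_cat size_nseq ltnn.
rewrite subnn scale1r big1 ?add0r// => j _.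
by rewrite nth_cat size_nseq ltn_ord nth_nseq ltn_ord scale0r.
Qed.

Lemma dominates_ge0 (V W : normedModType R) (x : V ^nat) (y : W ^nat) :
  dominates x y -> exists2 C, 0 <= C & forall s, sum_norm y s <= C * sum_norm x s.
Proof.
move=> [C /dominates_withP xy]; exists `|C| => // s.
by rewrite (le_trans (xy s))// ler_wpM2r ?sum_norm_ge0// ler_norm.
Qed.

(** The division by the norm of b normalizes the blocks. *)
Lemma block_spreading_model G E (xt : E ^nat) b : generates G xt ->
  null_ultra (ultra_block G b) -> 0 < sum_norm xt b ->
  exists (F : completeNormedModType R) (yt : F ^nat), spreading_model_in X yt /\
    forall s, sum_norm yt s = sum_norm xt [seq x * y | x <- s, y <- b] / sum_norm xt b.
Proof.
move=> Gx H0 b0; have Gb := generates_nbounded Gx; have [G1 GE] := Gx.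
have rE : ulim (ultra_block G b) (fun y => `|y|) = sum_norm xt b.
  have := iter_norm_block b [:: 1] Gb => /(congr1 (@^~ 0)) /=.
  rewrite cats0 map_id_in ?GE => [<-|? _]; last by rewrite mul1r.
  by apply: eq_ulim => y; rewrite add0r scale1r.
have [|F [yt [smy yE]]] := realize_ultra (nbounded_block b Gb) H0.
  by rewrite rE.
by exists F, yt; split=> // s; rewrite yE rE iter_norm_block// GE.
Qed.

(** The differences of generic vectors generate an unconditional spreading model,
    and unconditionality is invariant under equivalence. *)
Lemma positive_part_bounded E (xt : E ^nat) :
  unique_spreading_model X -> spreading_model_in X xt ->
  exists2 K, 0 <= K &
    forall s, sum_norm xt [seq Num.max a 0 | a <- s] <= K * sum_norm xt s.
Proof.
move=> uX smx; have [G Gx] := spreading_model_ultra smx.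
have Gb := generates_nbounded Gx.
have H0 := null_difference Gb.
have d0 : 0 < sum_norm xt [:: 1; -1].
  rewrite /sum_norm big_ord_recr big_ord1 /= scale1r scaleN1r normr_gt0 subr_eq0.
  exact/basic_sequence_neq/spreading_model_basic/smx.
have [F [dt [smd dtE]]] := block_spreading_model Gx H0 d0.
have [/dominates_ge0[C1 C10 xd] /dominates_ge0[C2 C20 dx]] := uX _ _ _ _ smx smd.
exists (C2 * C1); first exact: mulr_ge0.
move=> s; rewrite (le_trans (dx _))// -mulrA ler_wpM2l// (le_trans _ (xd _))//.
rewrite !dtE ler_pM2r ?invr_gt0// -!Gx.2 -!iter_norm_block//.
have -> : [seq Num.max a 0 | a <- s] =
    mkseq ((fun i => (0 < s`_i)%R%:R) \* (fun i => s`_i)) (size s).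
  rewrite -{1}[s](mkseq_nth 0) /mkseq -map_comp; apply: eq_map => i /=.
  by case: ltrP => _; rewrite ?mul1r ?mul0r.
rewrite -[X in _ <= iter_norm _ X _](mkseq_nth 0); apply: null_iter_norm_le => //.
  exact: nbounded_block.
by move=> i; case: ltrP => _; rewrite ?lexx ?ler01.
Qed.

(** A vector is the difference of its positive and negative parts, both of which
    it controls by unconditionality. *)
Lemma l1_of_positive E (xt : E ^nat) (d : R) :
  unique_spreading_model X -> spreading_model_in X xt -> 0 < d ->
  (forall s, (forall a, a \in s -> 0 <= a) -> d * \sum_(a <- s) a <= sum_norm xt s) ->
  exists2 C, 0 <= C & forall s, \sum_(a <- s) `|a| <= C * sum_norm xt s.
Proof.
move=> uX smx d0 dP; have [K K0 KP] := positive_part_bounded uX smx.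
exists (2 * K / d); first by rewrite !mulr_ge0// invr_ge0 ltW.
move=> s; rewrite mulrAC ler_pdivlMr// mulrC.
have pos (t : seq R) : d * \sum_(a <- t) Num.max a 0 <= K * sum_norm xt t.
  have := dP [seq Num.max a 0 | a <- t]; rewrite big_map => h.
  rewrite (le_trans _ (KP _))// h// => _ /mapP[a _ ->].
  by rewrite le_max lexx orbT.
have absE : \sum_(a <- s) `|a| = \sum_(a <- s) Num.max a 0 +
    \sum_(a <- [seq -1 * a | a <- s]) Num.max a 0.
  rewrite big_map -big_split /=; apply: eq_bigr => a _; rewrite mulN1r.
  have [a0|a0] := lerP 0 a.
    by rewrite ger0_norm// (max_idPr _) ?oppr_le0// addr0.
  by rewrite ltr0_norm// (max_idPl _) ?add0r// oppr_ge0 ltW.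
have := pos s; have := pos [seq -1 * a | a <- s].
rewrite sum_normZ normrN1 mul1r absE mulrDr; lra.
Qed.

(** If the spreading model has small convex combinations then the generating
    ultrafilter is null; otherwise it dominates l_1 on positive vectors. *)
Lemma l1_or_null : unique_spreading_model X ->
  (forall E (xt : E ^nat), spreading_model_in X xt ->
     exists2 C, 0 <= C & forall s, \sum_(a <- s) `|a| <= C * sum_norm xt s) \/
  (forall G E (xt : E ^nat), spreading_model_in X xt -> generates G xt ->
     null_ultra G).
Proof.
move=> uX.
have [[E [xt [smx [d [d0 dP]]]]]|no_l1] := pselect
  (exists E (xt : E ^nat), spreading_model_in X xt /\ exists d : R, 0 < d /\
     forall s, (forall a, a \in s -> 0 <= a) -> d * \sum_(a <- s) a <= sum_norm xt s).
  left=> F yt smy; have [C C0 CP] := l1_of_positive uX smx d0 dP.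
  have [_ /dominates_ge0[D D0 yx]] := uX _ _ _ _ smx smy.
  exists (C * D); first exact: mulr_ge0.
  by move=> s; rewrite (le_trans (CP s))// -mulrA ler_wpM2l.
right=> G E xt smx Gx; apply: null_small_combination.
  exact: generates_nbounded Gx.
move=> e e0; apply: contrapT => no_s; apply: no_l1; exists E, xt; split=> //.
exists e; split=> // s s0; rewrite leNgt; apply/negP => se; apply: no_s.
have S0 : 0 < \sum_(a <- s) a.
  by rewrite -(pmulr_rgt0 _ e0); apply: le_lt_trans se; exact: sum_norm_ge0.
exists [seq (\sum_(a <- s) a)^-1 * b | b <- s]; split.
- by move=> _ /mapP[b sb ->]; rewrite mulr_ge0 ?invr_ge0 ?(ltW S0) ?s0.
- by rewrite big_map -mulr_sumr mulVf// gt_eqF.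
- by rewrite Gx.2 sum_normZ gtr0_norm ?invr_gt0// mulrC ltr_pdivrMr.
Qed.

End ultra_of_spreading_model.

(** * Uniform domination *)

Section uniform_domination.
Context {R : realType} {X : completeNormedModType R}.

Let half : R := 2^-1.

(** The ultrafilter of the sums of 2^-m y_m for m < n, with y_m generic for G m
    after the previous choices, and its limit as n grows. *)
Fixpoint ultra_partial_sum (G : nat -> ultra X) n : ultra X :=
  if n is m.+1 then
    ultra_add (ultra_partial_sum G m) (ultra_scale (half ^+ m) (G m))
  else ultra_ret 0.

Definition ultra_series (U : ultra nat) (G : nat -> ultra X) : ultra X :=
  ultra_bind U (ultra_partial_sum G).

Section ultra_series.
Variables (U : ultra nat) (G : nat -> ultra X).
Hypothesis Unp : forall n, U [set k | (n <= k)%N].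
Hypothesis G1 : forall n, G n [set y | `|y| = 1].
Hypothesis G0 : forall n, null_ultra (G n).

Let Gb n : nbounded (G n).
Proof. by exists 1; apply: filterS (G1 n) => y /= ->. Qed.

Let half_ge0 n : 0 <= half ^+ n.
Proof. by rewrite exprn_ge0// invr_ge0. Qed.

Lemma ultra_partial_sum_le2 n : ultra_partial_sum G n [set y | `|y| <= 2].
Proof.
suff : ultra_partial_sum G n [set y | `|y| <= 2 - 2 * half ^+ n].
  by apply: filterS => y /= /le_trans; apply; rewrite gerBl mulr_ge0.
elim: n => [|n IH] /=; first by rewrite normr0 mulr1 subrr.
apply: filterS IH => y /= y2; apply: filterS (G1 n) => z /= z1.
rewrite (le_trans (ler_normD _ _))// normrZ z1 mulr1 ger0_norm//.
have -> : 2 * half ^+ n.+1 = half ^+ n by rewrite exprS mulrA divff// mul1r.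
lra.
Qed.

Let Sb n : nbounded (ultra_partial_sum G n).
Proof. by exists 2; exact: ultra_partial_sum_le2. Qed.

Let Gsb n : nbounded (ultra_scale (half ^+ n) (G n)).
Proof. exact: nbounded_scale. Qed.

Lemma ultra_partial_sum_null n : null_ultra (ultra_partial_sum G n).
Proof.
elim: n => [|n IH] /=; first exact: null_ret.
by apply: null_add => //; exact: null_scale.
Qed.

Lemma ultra_partial_sum_ge m n : (m < n)%N ->
  convex_ge (ultra_partial_sum G n) (ultra_scale (half ^+ m) (G m)).
Proof.
elim: n => // n IH; rewrite ltnS leq_eqVlt => /orP[/eqP->|/IH mn] /=.
  by apply: convex_ge_addr => //; exact: ultra_partial_sum_null.
move=> f fcl; apply: le_trans (mn f fcl) _.
by apply: convex_ge_addl fcl => //; exact: null_scale.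
Qed.

Lemma ultra_series_le2 : ultra_series U G [set y | `|y| <= 2].
Proof. by rewrite /=; apply: filterE => n; exact: ultra_partial_sum_le2. Qed.

Lemma ultra_series_nbounded : nbounded (ultra_series U G).
Proof. by exists 2; exact: ultra_series_le2. Qed.

Lemma ultra_series_ge m :
  convex_ge (ultra_series U G) (ultra_scale (half ^+ m) (G m)).
Proof.
move=> f fcl; apply/ler_addgt0Pr => e e0; rewrite -lerBlDr.
apply: ulim_ge_cst; first exact: convex_lip_ubounded ultra_series_nbounded fcl.
rewrite /=; apply: filterS (Unp m.+1) => n /= mn.
apply: filterS (ulimP (convex_lip_ubounded (Sb n) fcl) e0) => y /=.
have := ultra_partial_sum_ge mn fcl.
by rewrite ler_norml => ? /andP[? _]; lra.
Qed.

Lemma ultra_series_null : null_ultra (ultra_series U G).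
Proof. by apply: convex_ge_null (@ultra_series_ge 0) _; exact: null_scale. Qed.

Lemma ultra_series_norm : 0 < ulim (ultra_series U G) (fun y => `|y|) <= 2.
Proof.
have nub := convex_lip_ubounded ultra_series_nbounded convex_lip_norm.
apply/andP; split; last exact: ulim_le_cst nub ultra_series_le2.
apply: (@lt_le_trans _ _ 1) => //.
apply: le_trans (ultra_series_ge 0 convex_lip_norm).
rewrite expr0 ulim_map; apply: ulim_ge_cst.
  have := convex_lip_ubounded (Gb 0) convex_lip_norm.
  by rewrite /comp; under [X in _ -> ubounded _ X]eq_fun do rewrite scale1r.
by apply: filterS (G1 0) => y /=; rewrite scale1r => ->.
Qed.

End ultra_series.

(** If z dominated the spreading models of the x n only with constants 4^n, it
    could not dominate that of a series of the 2^-n x n. *)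
Lemma spreading_models_uniformly_dominated (Z : normedModType R) (z : Z ^nat) :
  unique_spreading_model X ->
  (exists (E : completeNormedModType R) (xt : E ^nat),
     spreading_model_in X xt /\ dominates z xt) ->
  exists2 C : R, 0 <= C & forall (E : completeNormedModType R) (xt : E ^nat),
    spreading_model_in X xt -> forall s, sum_norm xt s <= C * sum_norm z s.
Proof.
move=> uX [E0 [xt0 [sm0 /dominates_ge0[K K0 zx0]]]].
have [l1|allnull] := l1_or_null uX.
  have [C C0 CP] := l1 _ _ sm0; exists (C * K); first exact: mulr_ge0.
  move=> E xt smx s; rewrite (le_trans (spreading_model_le_l1 s smx))//.
  by rewrite (le_trans (CP s))// -mulrA ler_wpM2l.
have [U Unp] := nonprincipal_ultra.
apply: contrapT => noC.
have bad n : exists x : X ^nat, normalized x /\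
    exists (E : completeNormedModType R) (xt : E ^nat), [/\ spreading_model_in X xt,
      generates (ultra_map x U) xt &
      exists s, 4 ^+ n * sum_norm z s < sum_norm xt s].
  apply: contrapT => nox; apply: noC; exists (4 ^+ n); first exact: exprn_ge0.
  move=> E xt smx s; rewrite leNgt; apply/negP => lts; apply: nox.
  have [x [[x1 bx] smxx]] := smx; exists x; split=> //; exists E, xt; split=> //.
    split; first exact: ultra_map_normalized.
    by move=> t; exact: spreading_model_iter_norm.
  by exists s.
have [x xP] := choice bad.
pose G n := ultra_map (x n) U.
have G1 n : G n [set y | `|y| = 1] by apply: ultra_map_normalized; exact: (xP n).1.
have G0 n : null_ultra (G n).
  by have [_ [E [xt [smx Gx _]]]] := xP n; exact: allnull smx Gx.
have Gb n : nbounded (G n) by exists 1; apply: filterS (G1 n) => y /= ->.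
have /andP[r0 r2] := ultra_series_norm Unp G1 G0.
have [F [yt [smy yE]]] := realize_ultra (ultra_series_nbounded U G1)
  (ultra_series_null Unp G1 G0) r0.
have [/dominates_ge0[L L0 xy0] _] := uX _ _ _ _ sm0 smy.
have [n nLK] : exists n : nat, 2 * (L * K) <= n%:R.
  exists (Num.bound (2 * (L * K))); apply/ltW/archi_boundP.
  by rewrite !mulr_ge0.
have [_ [E [xt [smx Gx [s ltzx]]]]] := xP n.
have zs0 := sum_norm_ge0 z s.
have n4 : (n%:R : R) <= 2 ^+ n by rewrite -natrX ler_nat ltnW// ltn_expl.
have ge_yt : half ^+ n * sum_norm xt s <= 2 * sum_norm yt s.
  rewrite -Gx.2 -[X in X * _]ger0_norm ?exprn_ge0 ?invr_ge0//.
  rewrite -(iter_normZ _ _ _ (Gb n)) scaler0.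
  have := convex_ge_iter_norm s 0 (ultra_series_nbounded U G1)
    (nbounded_scale (half ^+ n) (Gb n)) (@ultra_series_ge U G Unp G1 G0 n).
  rewrite iter_norm_scale.
  rewrite (eq_map (fun b => mulrC b _)) => /le_trans; apply.
  rewrite yE mulrA ler_pdivlMr// mulrC ler_wpM2r//.
  exact: iter_norm_ge0 (ultra_series_nbounded U G1).
have yz : sum_norm yt s <= L * K * sum_norm z s.
  by rewrite (le_trans (xy0 s))// -mulrA ler_wpM2l.
have : 4 ^+ n * sum_norm z s < 2 ^+ n * (2 ^+ n * sum_norm z s).
  rewrite (lt_le_trans ltzx)//.
  have -> : sum_norm xt s = 2 ^+ n * (half ^+ n * sum_norm xt s).
    by rewrite mulrA -exprMn divff// expr1n mul1r.
  rewrite ler_wpM2l ?exprn_ge0// (le_trans ge_yt)//.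
  rewrite (le_trans (ler_wpM2l _ yz))// mulrA ler_wpM2r//.
  exact: le_trans nLK n4.
by rewrite mulrA -exprMn -natrM ltxx.
Qed.

(** ** Krivine's p *)

Lemma sum_norm_block_sequence (V : normedModType R) (x : V ^nat) m (b : 'I_m -> R) s :
  sum_norm (block_sequence x b) s =
  sum_norm x [seq c * d | c <- s, d <- [seq b k | k <- enum 'I_m]].
Proof.
rewrite /sum_norm; congr `|_|; elim/last_ind: s => [|s a IH].
  by rewrite /= !big_ord0.
have sb : size [seq b k | k <- enum 'I_m] = m by rewrite size_map size_enum_ord.
rewrite size_rcons big_ord_recr /= -cats1 allpairs_cat size_cat.
rewrite big_split_ord /=; congr (_ + _).
  rewrite (eq_bigr (fun i : 'I_(size s) => s`_i *: block_sequence x b i)).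
    by rewrite IH; apply: eq_bigr => i _; rewrite nth_cat ltn_ord.
  by move=> i _; rewrite nth_cat ltn_ord.
rewrite cats0 size_map sb nth_cat ltnn subnn /= scaler_sumr.
apply: eq_bigr => k _; rewrite size_allpairs sb scalerA nth_cat.
rewrite size_allpairs sb ltnNge leq_addr addKn /= (nth_map 0) ?sb//.
by rewrite nth_map_ord.
Qed.

Lemma norm_unit_vector (p : \bar R) (p1 : (1 <= p)%E) i :
  `|unit_vector_basis p1 i| = 1.
Proof.
have -> : unit_vector_basis p1 i =
    \sum_(j < i.+1) (j == ord_max)%:R *: unit_vector_basis p1 j.
  rewrite big_ord_recr /= eqxx scale1r big1 ?add0r// => j _.
  by rewrite -val_eqE /= ltn_eqF ?scale0r.
case: p p1 => [r| |] p1; [rewrite ellp_normE|rewrite ellp_norm_ooE|by have := p1].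
  rewrite big_ord_recr /= eqxx normr1 powR1 big1 ?add0r ?powR1// => j _.
  rewrite -val_eqE /= ltn_eqF// normr0 powR0// gt_eqF//.
  by move: p1; rewrite lee_fin; exact: lt_le_trans.
apply/eqP; rewrite eq_le; apply/andP; split.
  apply/bigmax_leP; split=> // j _; case: eqP => _; rewrite ?normr1 ?normr0//.
have := le_bigmax (0 : R) (fun j : 'I_i.+1 => `|(j == ord_max)%:R : R|) ord_max.
by rewrite eqxx normr1.
Qed.

Lemma sum_norm_unit_vectors (p : \bar R) (p1 : (1 <= p)%E) s :
  sum_norm (unit_vector_basis p1) s <= \sum_(a <- s) `|a|.
Proof.
rewrite /sum_norm (le_trans (ler_norm_sum _ _ _))// (big_nth 0) big_mkord.
by apply: ler_sum => i _; rewrite normrZ norm_unit_vector mulr1.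
Qed.

(** The constant of uniform domination applies to the spreading model of the
    normalized blocks, which on size s vectors is that of l_p up to a factor 4. *)
Lemma krivine_dominates (E : completeNormedModType R) (xt : E ^nat)
    (p : \bar R) (p1 : (1 <= p)%E) :
  unique_spreading_model X -> spreading_model_in X xt -> krivine_set xt p ->
  dominates xt (unit_vector_basis p1).
Proof.
move=> uX smx [p1' kp].
have {p1' kp} kp (n : nat) : exists b : seq R, forall s, size s = n ->
    2^-1 * sum_norm (unit_vector_basis p1) s
      <= sum_norm xt [seq c * d | c <- s, d <- b]
      <= 2 * sum_norm (unit_vector_basis p1) s.
  have [m [lambda lP]] := kp 1 n ltr01; exists [seq lambda k | k <- enum 'I_m] => s sn.
  have := lP (fun i => s`_i); rewrite /= -sum_norm_block_sequence /sum_norm sn.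
  by rewrite (eq_irrelevance p1 p1').
have [l1|allnull] := l1_or_null uX.
  have [C C0 CP] := l1 _ _ smx; exists C; apply/dominates_withP => s.
  exact: le_trans (sum_norm_unit_vectors p1 s) (CP s).
have [C C0 CP] : exists2 C : R, 0 <= C &
    forall (F : completeNormedModType R) (yt : F ^nat), spreading_model_in X yt ->
    forall s, sum_norm yt s <= C * sum_norm xt s.
  apply: spreading_models_uniformly_dominated => //; exists E, xt; split=> //.
  by exists 1; apply/dominates_withP => s; rewrite mul1r.
have [G Gx] := spreading_model_ultra smx.
exists (4 * C); apply/dominates_withP => s.
have [s0|sn0] := posnP (size s).
  by rewrite (size0nil s0) /sum_norm /= !big_ord0 !normr0 mulr0.
have [b bP] := kp (size s); have Gb := generates_nbounded Gx.
pose e0 : seq R := 1 :: nseq (size s).-1 0.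
have e0E (V : normedModType R) (x : V ^nat) : sum_norm x e0 = `|x 0%N|.
  rewrite /sum_norm big_ord_recl scale1r big1 ?addr0// => i _.
  by rewrite /= nth_nseq if_same scale0r.
have bE : sum_norm xt [seq c * d | c <- e0, d <- b] = sum_norm xt b.
  have fe : [seq x <- e0 | x != 0] = [:: 1].
    by rewrite /= oner_neq0 filter_nseq eqxx.
  rewrite -Gx.2 -iter_norm_block// -iter_norm_filter fe iter_norm_block// Gx.2.
  by rewrite /= cats0 map_id_in// => d _; rewrite mul1r.
have /bP : size e0 = size s by rewrite /= size_nseq prednK.
rewrite bE e0E norm_unit_vector !mulr1 => /andP[r1 r2].
have r0 : 0 < sum_norm xt b by apply: lt_le_trans r1.
have [F [yt [smy yE]]] :=
  block_spreading_model Gx (null_block b Gb (allnull _ _ _ smx Gx)) r0.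
have /andP[+ _] := bP s erefl.
have := CP _ _ smy s; rewrite yE ler_pdivrMr// => h1 h2.
have : C * sum_norm xt s * sum_norm xt b <= C * sum_norm xt s * 2.
  by rewrite ler_wpM2l// mulr_ge0// sum_norm_ge0.
lra.
Qed.

End uniform_domination.

(** * Norms multiplicative on tensor products *)

Section growth.
Context {R : realType}.

Lemma archimedean_le0 (a c : R) : (forall n : nat, a * n%:R <= c) -> a <= 0.
Proof.
move=> ac; rewrite leNgt; apply/negP => a0.
have c0 : 0 <= c by have := ac 0%N; rewrite mulr0.
have := ac (Num.bound (c / a)); rewrite leNgt => /negP; apply.
by rewrite mulrC -ltr_pdivrMr// archi_boundP// divr_ge0// ltW.
Qed.

Lemma expn_linear_le1 (q A : R) : 0 <= q ->
  (forall n, (0 < n)%N -> q ^+ n <= A * n%:R) -> q <= 1.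
Proof.
move=> q0 qA; rewrite leNgt; apply/negP => q1.
pose h := q - 1; have h0 : 0 < h by rewrite subr_gt0.
have bern n : 1 + n%:R * h <= q ^+ n.
  elim: n => [|n IH]; first by rewrite mul0r addr0 expr0.
  rewrite exprS; apply: le_trans (ler_wpM2l q0 IH).
  rewrite -subr_ge0 (_ : _ - _ = n%:R * h ^+ 2) ?mulr_ge0 ?(ltW h0)//.
  by rewrite /h; ring.
suff : h ^+ 2 <= 0 by rewrite leNgt exprn_gt0.
apply: (@archimedean_le0 _ (2 * A)) => n.
case: n => [|n].
  rewrite mulr0; have := qA 1%N isT; rewrite expr1 mulr1; lra.
have := qA (n.+1 * 2)%N; rewrite muln_gt0 => /(_ isT); rewrite exprM natrM => qA2.
have b1 : n.+1%:R * h <= q ^+ n.+1 by rewrite (le_trans _ (bern n.+1))// lerDr.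
have b2 : (n.+1%:R * h) ^+ 2 <= (q ^+ n.+1) ^+ 2.
  by rewrite lerXn2r ?nnegrE ?exprn_ge0// mulr_ge0// ltW.
have n0 : 0 < n.+1%:R :> R by [].
rewrite -(ler_pM2l n0) mulrA; move: b2 qA2; rewrite exprMn; nra.
Qed.

(** The slope is the supremum of the (f k - c) / k.  Each (f j + c) / j is an upper
    bound, as one sees by estimating f (j k) in two ways. *)
Lemma almost_additive (f : nat -> R) (c : R) :
  (forall j k, `|f (j + k)%N - (f j + f k)| <= c) ->
  exists b, forall k, `|f k - b * k%:R| <= c.
Proof.
move=> fc; have c0 : 0 <= c by apply: le_trans (fc 0%N 0%N).
have f0 : `|f 0%N| <= c by have := fc 0%N 0%N; rewrite addn0 opprD addNKr normrN.
have fcP j k : f (j + k)%N - (f j + f k) <= c /\ - c <= f (j + k)%N - (f j + f k).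
  by have := fc j k; rewrite ler_norml => /andP[].
have fM j k : j.+1%:R * (f k - c) <= f (j.+1 * k)%N - c /\
    f (j.+1 * k)%N + c <= j.+1%:R * (f k + c).
  elim: j => [|j [IH1 IH2]]; first by rewrite !mul1r mul1n.
  have [h1 h2] := fcP k (j.+1 * k)%N; rewrite mulSn -natr1.
  by move: IH1 IH2; rewrite !mulrDl !mul1r; lra.
pose A := [set (f k.+1 - c) / k.+1%:R | k in [set: nat]].
have Aub j : ubound A ((f j.+1 + c) / j.+1%:R).
  move=> _ [k _ <-]; rewrite ler_pdivrMr// mulrAC ler_pdivlMr//.
  have [h1 _] := fM j k.+1; have [_ h2] := fM k j.+1.
  rewrite mulnC in h2; lra.
have Asup : has_sup A.
  split; first by exists ((f 1%N - c) / 1%:R), 0%N.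
  by exists ((f 1%N + c) / 1%:R); exact: Aub.
exists (sup A) => -[|k]; first by rewrite mulr0 subr0.
have h1 : (f k.+1 - c) / k.+1%:R <= sup A by apply: (sup_upper_bound Asup); exists k.
have h2 : sup A <= (f k.+1 + c) / k.+1%:R.
  by apply: ge_sup; [exact: Asup.1|exact: Aub].
move: h1 h2; rewrite ler_pdivrMr// ler_pdivlMr// => h1 h2.
by rewrite ler_norml; apply/andP; lra.
Qed.

End growth.

Section tensor_norm.
Context {R : realType}.
Variables (N : seq R -> R) (D : R).
Hypothesis N1 : N [:: 1] = 1.
Hypothesis N_ub : forall s, N s <= \sum_(x <- s) `|x|.
Hypothesis NZ : forall c s, N [seq c * x | x <- s] = `|c| * N s.
Hypothesis ND : forall n (f g : nat -> R),
  N (mkseq (f \+ g) n) <= N (mkseq f n) + N (mkseq g n).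
Hypothesis N_le : forall n (f g : nat -> R),
  (forall i, (i < n)%N -> 0 <= f i <= g i) -> N (mkseq f n) <= N (mkseq g n).
Hypothesis N_filter : forall s, N [seq x <- s | x != 0] = N s.
Hypothesis D1 : 1 <= D.
Hypothesis N_tensor : forall s t, 0 < N t ->
  N [seq x * y | x <- s, y <- t] <= D * (N s * N t) /\
  N s * N t <= D * N [seq x * y | x <- s, y <- t].

Let D0 : 0 < D. Proof. exact: lt_le_trans D1. Qed.

(** The fundamental function of the basis in the sense of Banach space theory. *)
Definition fundamental n : R := N (nseq n 1).
Local Notation sigma := fundamental.

Let N_indicator (P : pred nat) n :
  N (mkseq (fun i => (P i)%:R) n) = sigma (count P (iota 0 n)).
Proof.
rewrite /sigma -N_filter; congr N; rewrite /mkseq.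
elim: (iota 0 n) => //= i s ->; case: (P i) => /=; first by rewrite oner_neq0.
by rewrite eqxx.
Qed.

Let nseqE n (c : R) : nseq n c = mkseq (fun=> c) n.
Proof. by elim: n => // n IH; rewrite mkseq_cons /= IH. Qed.

Let sigma_le m n : (m <= n)%N -> sigma m <= sigma n.
Proof.
move=> mn; rewrite {2}/sigma nseqE.
apply: (@le_trans _ _ (N (mkseq (fun i => (i < m)%:R) n))); last first.
  by apply: N_le => i _; case: ltnP; rewrite ?lexx ?ler01.
rewrite N_indicator le_eqVlt; apply/orP; left; apply/eqP; congr sigma.
rewrite -(subnKC mn) iotaD count_cat add0n.
rewrite (_ : count _ (iota 0 m) = m); last first.
  rewrite -[RHS](size_iota 0) -count_predT; apply: eq_in_count => i.
  by rewrite mem_iota.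
rewrite (_ : count _ _ = 0%N) ?addn0//; apply/eqP; rewrite -leqn0 leqNgt -has_count.
by apply/hasPn => i; rewrite mem_iota => /andP[mi _]; rewrite -leqNgt.
Qed.

Let sigma_ge1 n : (0 < n)%N -> 1 <= sigma n.
Proof. by move=> n0; rewrite -N1 -/(sigma 1); exact: sigma_le. Qed.

Let sigma_ub n : sigma n <= n%:R.
Proof.
rewrite (le_trans (N_ub _))// big_nseq iter_addr_0 normr1.
by rewrite lexx.
Qed.

Let sigmaM m n : (0 < n)%N ->
  sigma (m * n) <= D * (sigma m * sigma n) /\ sigma m * sigma n <= D * sigma (m * n).
Proof.
move=> n0; have := N_tensor (nseq m 1) (lt_le_trans ltr01 (sigma_ge1 n0)).
have -> : [seq x * y | x <- nseq m 1, y <- nseq n 1] = nseq (m * n) (1 : R).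
  elim: m => //= m ->; rewrite mulSn nseqD; congr (_ ++ _).
  by rewrite map_nseq mul1r.
by [].
Qed.

(** Along powers of two, the logarithm of the fundamental function is almost
    additive; monotonicity fills in the other integers. *)
Lemma fundamental_power : exists a : R, 0 <= a <= 1 /\ exists2 K, 0 < K &
  forall n, (0 < n)%N -> sigma n <= K * n%:R `^ a /\ n%:R `^ a <= K * sigma n.
Proof.
have sig0 k : 0 < sigma (2 ^ k) by rewrite (lt_le_trans ltr01)// sigma_ge1 ?expn_gt0.
pose f k := ln (sigma (2 ^ k)); pose c := ln D.
have fE k : expR (f k) = sigma (2 ^ k) by rewrite lnK// posrE.
have [b bP] : exists b, forall k, `|f k - b * k%:R| <= c.
  apply: almost_additive => j k; have [] := @sigmaM (2 ^ j) (2 ^ k).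
    by rewrite expn_gt0.
  rewrite -expnD => h1 h2; rewrite /f /c -lnM ?posrE//.
  have s1 := sig0 j; have s2 := sig0 k; have s3 := sig0 (j + k)%N.
  rewrite -ln_div ?posrE ?mulr_gt0// ler_norml; apply/andP; split.
    rewrite lerNl -lnV ?posrE ?divr_gt0 ?mulr_gt0//.
    rewrite ler_ln ?posrE ?invr_gt0 ?divr_gt0 ?mulr_gt0//.
    by rewrite invf_div ler_pdivrMr.
  by rewrite ler_ln ?posrE ?divr_gt0 ?mulr_gt0// ler_pdivrMr// mulr_gt0.
have f_ge0 k : 0 <= f k by rewrite ln_ge0// sigma_ge1// expn_gt0.
have f_le k : f k <= k%:R * ln 2.
  rewrite mulrC mulr_natr -lnXn// ler_ln ?posrE ?exprn_gt0//.
  by rewrite (le_trans (sigma_ub _))// natrX.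
have b0 : 0 <= b.
  rewrite -oppr_le0; apply: (@archimedean_le0 _ _ c) => k.
  by have := bP k; have := f_ge0 k; rewrite ler_norml => ? /andP[_ ?]; lra.
have b2 : b <= ln 2.
  rewrite -subr_le0; apply: (@archimedean_le0 _ _ c) => k.
  by have := bP k; have := f_le k; rewrite ler_norml => ? /andP[? _]; lra.
have ln2 : 0 < ln 2 :> R by rewrite ln_gt0// ltr1n.
pose a := b / ln 2.
have a0 : 0 <= a by rewrite divr_ge0// ltW.
have pow2 k : (2 ^ k)%:R `^ a = expR (b * k%:R) :> R.
  rewrite /powR natrX expf_eq0 pnatr_eq0 andbF; congr expR.
  by rewrite lnXn// -[ln 2 *+ k]mulr_natr mulrA /a divfK ?gt_eqF.
have sig_ub k : sigma (2 ^ k) <= expR c * expR (b * k%:R).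
  rewrite -fE -expRD ler_expR.
  by have := bP k; rewrite ler_norml => /andP[_ ?]; lra.
have sig_lb k : expR (b * k%:R) <= expR c * sigma (2 ^ k).
  rewrite -fE -expRD ler_expR.
  by have := bP k; rewrite ler_norml => /andP[? _]; lra.
exists a; split; first by rewrite a0 /a ler_pdivrMr// mul1r.
exists (expR (c + b)); first exact: expR_gt0.
move=> n n0; have /andP[kn nk] := trunc_log_bounds (isT : (1 < 2)%N) n0.
set k := trunc_log 2 n in kn nk.
have kS : expR (b * k.+1%:R) = expR b * expR (b * k%:R).
  by rewrite -expRD; congr expR; rewrite -natr1; lra.
split.
  rewrite (le_trans (sigma_le (ltnW nk)))// (le_trans (sig_ub _))// kS.
  rewrite expRD -mulrA ler_wpM2l ?expR_ge0// ler_wpM2l ?expR_ge0// -pow2.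
  by apply: ge0_ler_powR => //; rewrite ?nnegrE// ler_nat.
apply: (@le_trans _ _ ((2 ^ k.+1)%:R `^ a)).
  by apply: ge0_ler_powR => //; rewrite ?nnegrE// ler_nat ltnW.
rewrite pow2 kS [c + b]addrC expRD -mulrA ler_wpM2l ?expR_ge0//.
by rewrite (le_trans (sig_lb _))// ler_wpM2l ?expR_ge0// sigma_le.
Qed.

Let sumr_count (T : Type) (P : pred T) (s : seq T) :
  \sum_(x <- s) (P x)%:R = (count P s)%:R :> R.
Proof. by elim: s => [|x s IH] /=; rewrite ?big_nil// big_cons IH natrD. Qed.

Let N_sum L n (f : nat -> nat -> R) :
  N (mkseq (fun i => \sum_(j < L) f j i) n) <= \sum_(j < L) N (mkseq (f j) n).
Proof.
elim: L => [|L IH].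
  rewrite big_ord0 (le_trans (N_ub _))// big_map big1_seq// => i _.
  by rewrite big_ord0 normr0.
rewrite big_ord_recr /= (le_trans _ (lerD IH (lexx _)))//.
rewrite [X in N X](_ : _ = mkseq ((fun i => \sum_(j < L) f j i) \+ f L) n); last first.
  by apply: eq_mkseq => i /=; rewrite big_ord_recr.
exact: ND.
Qed.

Let N_mulindicator (c : R) (P : pred nat) n : 0 <= c ->
  N (mkseq (fun i => c * (P i)%:R) n) = c * sigma (count P (iota 0 n)).
Proof.
move=> c0; rewrite -N_indicator -[in RHS](ger0_norm c0) -NZ; congr N.
by rewrite /mkseq -map_comp.
Qed.

Definition dyadic j (x : R) : bool := (2 ^+ j <= x < 2 ^+ j.+1).

Lemma dyadic_ex L (x : R) : 1 <= x < 2 ^+ L -> exists2 j : 'I_L, true & dyadic j x.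
Proof.
elim: L => [|L IH] /andP[x1 xL]; first by move: xL; rewrite expr0 ltNge x1.
have [xL'|xL'] := ltrP x (2 ^+ L).
  have [|j _ jx] := IH; first by rewrite x1.
  by exists (widen_ord (leqnSn L) j).
by exists ord_max => //=; rewrite /dyadic xL' xL.
Qed.

(** On its j-th dyadic level set the vector is, up to a factor 2, a multiple of an
    indicator function, for which the norm is known up to a constant.  The
    triangle inequality and monotonicity then bound the norm from both sides, with
    a loss proportional to the number L of levels. *)
Section dyadic_levels.
Variables (a K : R) (L : nat) (s : seq R).
Hypothesis a01 : 0 < a <= 1.
Hypothesis K0 : 0 < K.
Hypothesis sigmaK : forall n, (0 < n)%N ->
  sigma n <= K * n%:R `^ a /\ n%:R `^ a <= K * sigma n.
Hypothesis L0 : (0 < L)%N.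
Hypothesis sL : forall x, x \in s -> 1 <= x < 2 ^+ L.

Let p := a^-1.
Let S := \sum_(x <- s) x `^ p.
Let cnt j := count (dyadic j) s.
Let u j : R := 2 ^+ j * (cnt j)%:R `^ a.

Let a0 : 0 < a. Proof. by case/andP: a01. Qed.
Let p0 : 0 < p. Proof. by rewrite invr_gt0. Qed.
Let pa : p * a = 1. Proof. by rewrite mulVf// gt_eqF. Qed.
Let ap : a * p = 1. Proof. by rewrite mulfV// gt_eqF. Qed.

Let sigmaK0 n : sigma n <= K * n%:R `^ a /\ n%:R `^ a <= K * sigma n.
Proof.
have [->|/sigmaK//] := posnP n; rewrite powR0 ?gt_eqF// mulr0.
suff -> : sigma 0 = 0 by rewrite mulr0.
by have := NZ 0 [::]; rewrite normr0 mul0r.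
Qed.

Let cntE j : cnt j = count (fun i => dyadic j s`_i) (iota 0 (size s)).
Proof. by rewrite /cnt -{1}[s](mkseq_nth 0) count_map. Qed.

Let uE j : u j = ((2 ^+ j) `^ p * (cnt j)%:R) `^ a.
Proof. by rewrite powRM ?powR_ge0// -powRrM pa powRr1 ?exprn_ge0. Qed.

Let s0 x : x \in s -> 0 <= x.
Proof. by move=> /sL/andP[x1 _]; exact: le_trans x1. Qed.

Let sum_count (c : R) j : \sum_(x <- s) (dyadic j x)%:R * c = (cnt j)%:R * c.
Proof. by rewrite -mulr_suml sumr_count. Qed.

Let u_le j : u j <= S `^ a.
Proof.
rewrite uE; apply: ge0_ler_powR; rewrite ?nnegrE ?(ltW a0)//.
  by apply: sumr_ge0 => x _; exact: powR_ge0.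
rewrite mulrC -sum_count /S big_seq [leRHS]big_seq; apply: ler_sum => x xs.
have [/andP[jx _]|_] := boolP (dyadic j x); last by rewrite mul0r powR_ge0.
by rewrite mul1r ge0_ler_powR ?nnegrE ?exprn_ge0 ?(s0 xs) ?(ltW p0).
Qed.

Let u_leN j : u j <= K * N s.
Proof.
apply: (@le_trans _ _ (K * (2 ^+ j * sigma (cnt j)))).
  by rewrite mulrCA ler_wpM2l ?exprn_ge0//; have [] := sigmaK0 (cnt j).
rewrite ler_wpM2l ?(ltW K0)// cntE -N_mulindicator ?exprn_ge0//.
rewrite -[in leRHS](mkseq_nth 0 s); apply: N_le => i ilt.
have si : s`_i \in s by exact: mem_nth.
case: (boolP (dyadic j s`_i)) => [/andP[jx _]|_].
  by rewrite mulr1 exprn_ge0.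
by rewrite mulr0 lexx s0.
Qed.

Lemma dyadic_upper : N s <= 2 * K * L%:R * S `^ a.
Proof.
apply: (@le_trans _ _ (\sum_(j < L) 2 ^+ j.+1 * sigma (cnt j))).
  rewrite -{1}[s](mkseq_nth 0).
  apply: (@le_trans _ _ (N (mkseq (fun i =>
    \sum_(j < L) 2 ^+ j.+1 * (dyadic j s`_i)%:R) (size s)))).
    apply: N_le => i ilt; have si : s`_i \in s by exact: mem_nth.
    rewrite s0//=; have [j _ jx] := dyadic_ex (sL si).
    rewrite (bigD1 j)//= jx mulr1; have /andP[_ /ltW/le_trans] := jx; apply.
    by rewrite lerDl sumr_ge0// => k _; rewrite mulr_ge0 ?exprn_ge0.
  have := N_sum L (size s) (fun j i => 2 ^+ j.+1 * (dyadic j s`_i)%:R).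
  move=> /le_trans; apply; apply: ler_sum => j _.
  by rewrite N_mulindicator ?exprn_ge0// cntE.
rewrite mulrAC -mulrA mulr_natr -[L in leRHS]card_ord -sumr_const.
rewrite mulr_sumr; apply: ler_sum => j _.
have [h _] := sigmaK0 (cnt j).
rewrite exprS -!mulrA ler_wpM2l// (le_trans (ler_wpM2l _ h)) ?exprn_ge0//.
by rewrite mulrCA ler_wpM2l ?(ltW K0)// u_le.
Qed.

Lemma dyadic_lower : S `^ a <= 2 * K * L%:R * N s.
Proof.
have KN0 : 0 <= K * N s by apply: le_trans (u_leN 0); rewrite mulr_ge0 ?powR_ge0.
have KN20 : 0 <= 2 * (K * N s) by rewrite mulr_ge0.
have SL : S <= L%:R * (2 * (K * N s)) `^ p.
  apply: (@le_trans _ _ (\sum_(j < L) (2 ^+ j.+1) `^ p * (cnt j)%:R)).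
    under eq_bigr do rewrite mulrC -sum_count.
    rewrite exchange_big /S big_seq [leRHS]big_seq; apply: ler_sum => x xs.
    have [j _ jx] := dyadic_ex (sL xs).
    rewrite (bigD1 j)//= jx mul1r; have /andP[_ xj] := jx.
    rewrite (@le_trans _ _ ((2 ^+ j.+1) `^ p))//.
      by rewrite ge0_ler_powR ?nnegrE ?exprn_ge0 ?(s0 xs) ?(ltW p0) ?(ltW xj).
    by rewrite lerDl sumr_ge0// => k _; rewrite mulr_ge0 ?powR_ge0.
  rewrite mulr_natl -[L in leRHS]card_ord -sumr_const; apply: ler_sum => j _.
  rewrite exprS powRM ?exprn_ge0// powRM// -mulrA ler_wpM2l ?powR_ge0//.
  have -> : (2 ^+ j) `^ p * (cnt j)%:R = u j `^ p.
    by rewrite uE -powRrM ap powRr1// mulr_ge0 ?powR_ge0.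
  rewrite ge0_ler_powR ?nnegrE ?u_leN// ?(ltW p0)//.
  by rewrite /u mulr_ge0 ?powR_ge0.
apply: (@le_trans _ _ ((L%:R * (2 * (K * N s)) `^ p) `^ a)).
  rewrite ge0_ler_powR ?nnegrE ?(ltW a0)//.
    by apply: sumr_ge0 => x _; exact: powR_ge0.
  by rewrite mulr_ge0 ?powR_ge0.
rewrite powRM ?powR_ge0// -powRrM pa powRr1//.
rewrite [leRHS](_ : _ = L%:R * (2 * (K * N s))); last by rewrite mulrAC mulrC -mulrA.
have La : L%:R `^ a <= L%:R :> R.
  by rewrite -[leRHS]powRr1//; apply: ler_powR; rewrite ?ler1n//; case/andP: a01.
by rewrite ler_wpM2r.
Qed.

End dyadic_levels.

Section tensor_power.
Variables (a K : R) (L : nat) (s : seq R).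
Hypothesis a01 : 0 < a <= 1.
Hypothesis K0 : 0 < K.
Hypothesis sigmaK : forall n, (0 < n)%N ->
  sigma n <= K * n%:R `^ a /\ n%:R `^ a <= K * sigma n.
Hypothesis s_gt0 : (0 < size s)%N.
Hypothesis sL : forall x, x \in s -> 1 <= x <= 2 ^+ L.

Let S := \sum_(x <- s) x `^ a^-1.

Fixpoint tensor_power k : seq R :=
  if k is j.+1 then [seq x * y | x <- tensor_power j, y <- s] else [:: 1].

Let tensor_power_itv k x : x \in tensor_power k -> 1 <= x <= 2 ^+ (L * k).
Proof.
elim: k x => [|k IH] x; first by rewrite inE muln0 expr0 => /eqP->; rewrite lexx.
case/allpairsP => -[y z] /= [/IH/andP[y1 yL] /sL/andP[z1 zL] ->].
rewrite mulnS addnC exprD; apply/andP; split.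
  by rewrite -[1]mulr1 ler_pM.
by rewrite ler_pM// (le_trans ler01).
Qed.

Let sum_tensor_power k : \sum_(x <- tensor_power k) x `^ a^-1 = S ^+ k.
Proof.
elim: k => [|k IH]; first by rewrite big_seq1 powR1.
rewrite /= big_allpairs_dep exprSr -IH mulr_suml big_seq [RHS]big_seq.
apply: eq_bigr => x /tensor_power_itv/andP[x1 _]; rewrite /S mulr_sumr.
rewrite big_seq [RHS]big_seq; apply: eq_bigr => y /sL/andP[y1 _].
by rewrite powRM// (le_trans ler01).
Qed.

Let S1 : 1 <= S.
Proof.
rewrite /S; case: s s_gt0 sL => // x t _ xL; rewrite big_cons.
have /andP[x1 _] := xL x (mem_head _ _).
rewrite -[leLHS]addr0 lerD//.
  have e1 : 1 `^ a^-1 = 1 :> R by rewrite powR1.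
  rewrite -[leLHS]e1 ge0_ler_powR ?nnegrE ?(le_trans ler01 x1)//.
  by rewrite invr_ge0; case/andP: a01 => /ltW.
by apply: sumr_ge0 => y _; exact: powR_ge0.
Qed.

Let Ns0 : 0 < N s.
Proof.
rewrite (lt_le_trans ltr01)// (le_trans (sigma_ge1 s_gt0))// /sigma nseqE.
rewrite -[in leRHS](mkseq_nth 0 s); apply: N_le => i ilt.
by have /sL/andP[-> _] := mem_nth 0 ilt; rewrite ler01.
Qed.

Let N_tensor_power k : N (tensor_power k) <= (D * N s) ^+ k /\
  N s ^+ k <= D ^+ k * N (tensor_power k).
Proof.
elim: k => [|k [IH1 IH2]]; first by rewrite /= N1 !expr0 mulr1.
have [h1 h2] := N_tensor (tensor_power k) Ns0; split=> /=.
  rewrite (le_trans h1)// exprSr mulrCA ler_wpM2r// mulr_ge0//; exact: ltW.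
rewrite exprSr (le_trans (ler_wpM2r (ltW Ns0) IH2))// -mulrA exprSr -mulrA.
by rewrite ler_wpM2l// exprn_ge0// ltW.
Qed.

Let S0 : 0 < S `^ a. Proof. by rewrite powR_gt0// (lt_le_trans ltr01). Qed.

Let powS k : (S ^+ k) `^ a = (S `^ a) ^+ k.
Proof.
have S00 : 0 <= S by exact: le_trans S1.
by rewrite -powR_mulrn// -powRrM mulrC powRrM powR_mulrn// ltW.
Qed.

Let linear k : (0 < k)%N -> 2 * K * (L * k).+1%:R <= 2 * K * L.+1%:R * k%:R.
Proof.
move=> k0; rewrite -[leRHS]mulrA ler_wpM2l ?mulr_ge0 ?(ltW K0)//.
by rewrite -natrM ler_nat mulSn addnC -addn1 leq_add2l.
Qed.

(** The dyadic comparison loses a factor linear in the number of dyadic levels,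
    hence linear in k for the k-th tensor power: taking k-th roots, it loses
    nothing. *)
Lemma tensor_power_lp : N s <= D * S `^ a /\ S `^ a <= D * N s.
Proof.
have sk k x : x \in tensor_power k -> 1 <= x < 2 ^+ (L * k).+1.
  move=> /tensor_power_itv/andP[-> xL] /=; rewrite (le_lt_trans xL)//.
  by rewrite ltr_eXn2l ?ltr1n.
have up k := dyadic_upper a01 K0 sigmaK (sk k).
have lo k := dyadic_lower a01 K0 sigmaK (ltn0Sn _) (sk k).
have DNs k : 0 <= D ^+ k by rewrite exprn_ge0// ltW.
split.
  rewrite -[leRHS]mul1r -ler_pdivrMr ?mulr_gt0//.
  apply: (@expn_linear_le1 _ _ (2 * K * L.+1%:R)).
    by rewrite divr_ge0 ?mulr_ge0// ltW.
  move=> k k0; rewrite (le_trans _ (linear k0))//.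
  rewrite expr_div_n ler_pdivrMr ?exprn_gt0 ?mulr_gt0// exprMn.
  have [_ h] := N_tensor_power k; rewrite (le_trans h)//.
  rewrite mulrCA ler_wpM2l// -powS -(sum_tensor_power k); exact: up.
rewrite -[leRHS]mul1r -ler_pdivrMr ?mulr_gt0//.
apply: (@expn_linear_le1 _ _ (2 * K * L.+1%:R)).
  by rewrite divr_ge0 ?mulr_ge0// ltW.
move=> k k0; rewrite (le_trans _ (linear k0))//.
rewrite expr_div_n ler_pdivrMr ?exprn_gt0 ?mulr_gt0// -powS -(sum_tensor_power k).
rewrite (le_trans (lo k))// ler_wpM2l//; last by have [] := N_tensor_power k.
by rewrite !mulr_ge0 ?(ltW K0).
Qed.

End tensor_power.

(** The tensor power argument of Aubrun and Nechita, who treat symmetric norms;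
    here the place of symmetry is taken by invariance under insertion of zeros,
    which gives indicator functions of sets of equal size the same norm. *)
Theorem tensor_norm_lp : (exists K, forall n, sigma n <= K) \/
  exists2 a : R, 0 < a <= 1 & forall s, (forall x, x \in s -> 0 < x) ->
    N s <= D * (\sum_(x <- s) x `^ a^-1) `^ a /\
    (\sum_(x <- s) x `^ a^-1) `^ a <= D * N s.
Proof.
have [a [/andP[a0 a1] [K K0 sigK]]] := fundamental_power.
have sig_nil : N [::] = 0 by have := NZ 0 [::]; rewrite normr0 mul0r.
have [a_eq0|a_neq0] := eqVneq a 0.
  left; exists K => n; have [->|n0] := posnP n; first by rewrite /sigma sig_nil ltW.
  by have [+ _] := sigK n n0; rewrite a_eq0 powRr0 mulr1.
right; exists a => [|s s0]; first by rewrite lt_neqAle eq_sym a_neq0 a0.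
have [->|sn] := eqVneq s [::].
  by rewrite sig_nil big_nil powR0// !mulr0.
have s_gt0 : (0 < size s)%N by case: (s) sn.
(* rescaling makes all entries at least one *)
pose c := \sum_(x <- s) x^-1.
have cx x : x \in s -> 1 <= c * x.
  move=> xs; rewrite -ler_pdivrMr ?s0// mul1r /c (big_rem x)//= lerDl.
  rewrite big_seq sumr_ge0// => y /mem_rem/s0; rewrite invr_ge0; exact: ltW.
have c0 : 0 < c.
  have [x xs] : exists x, x \in s.
    by case: (s) sn => // x t _; exists x; rewrite mem_head.
  by rewrite -(pmulr_lgt0 _ (s0 x xs)) (lt_le_trans ltr01)// cx.
pose M := c * \sum_(x <- s) x.
have xM x : x \in s -> c * x <= M.
  move=> xs; rewrite ler_wpM2l ?(ltW c0)// (big_rem x)//= lerDl.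
  rewrite big_seq sumr_ge0// => y /mem_rem/s0; exact: ltW.
pose L := Num.bound `|M|.
have ML : M <= 2 ^+ L.
  rewrite (le_trans (ler_norm _))// (le_trans (ltW (archi_boundP (normr_ge0 _))))//.
  by rewrite -natrX ler_nat ltnW// ltn_expl.
have sL x : x \in [seq c * x | x <- s] -> 1 <= x <= 2 ^+ L.
  by move=> /mapP[y ys ->]; rewrite cx//= (le_trans (xM _ ys)).
have a01 : 0 < a <= 1 by rewrite lt_neqAle eq_sym a_neq0 a0.
have := tensor_power_lp a01 K0 sigK _ sL; rewrite size_map => /(_ s_gt0).
have -> : (\sum_(x <- [seq c * x | x <- s]) x `^ a^-1) `^ a =
    c * (\sum_(x <- s) x `^ a^-1) `^ a.
  rewrite big_map (eq_big_seq (fun x => c `^ a^-1 * x `^ a^-1)); last first.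
    by move=> x xs; rewrite powRM// ltW// s0.
  rewrite -mulr_sumr powRM ?powR_ge0//; last by apply: sumr_ge0 => x _; exact: powR_ge0.
  by rewrite -powRrM mulVf// powRr1// ltW.
by rewrite NZ gtr0_norm// ![D * (c * _)]mulrCA !ler_pM2l.
Qed.

End tensor_norm.

(** * Uniformly equivalent spreading models *)

Section unit_vector_norms.
Context {R : realType}.

Lemma sum_norm_lp (r : R) (r1 : (1 <= r%:E)%E) s :
  sum_norm (unit_vector_basis r1) s = (\sum_(x <- s) `|x| `^ r) `^ r^-1.
Proof. by rewrite /sum_norm ellp_normE (big_nth 0) big_mkord. Qed.

Lemma sum_norm_l1 s :
  sum_norm (unit_vector_basis (@lexx _ _ (1%E : \bar R))) s = \sum_(x <- s) `|x|.
Proof.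
rewrite [LHS]sum_norm_lp invr1 powRr1; last by apply: sumr_ge0 => x _; exact: powR_ge0.
by apply: eq_bigr => x _; rewrite powRr1.
Qed.

End unit_vector_norms.

Section null_lattice.
Context {R : realType} {X : normedModType R} (G : ultra X).
Hypotheses (Gb : nbounded G) (G0 : null_ultra G).

Let mkE (s : seq R) (f : R -> R) :
  [seq f x | x <- s] = mkseq (fun i => f s`_i) (size s).
Proof. by rewrite -{1}[s](mkseq_nth 0) /mkseq -map_comp. Qed.

(** The two signs are dealt with separately, each by restriction. *)
Let sign_le (f g : R -> R) s : (forall x, `|f x| = `|g x|) ->
  iter_norm G [seq f x | x <- s] 0 <= 2 * iter_norm G [seq g x | x <- s] 0.
Proof.
move=> fg; rewrite !mkE; set n := size s.
pose t i : R := (f s`_i == g s`_i)%:R.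
have fE : (fun i => f s`_i) =
    (t \* (fun i => g s`_i)) \+
    (fun i => -1 * ((fun i => 1 - t i) \* (fun i => g s`_i)) i).
  apply/funext => i /=; rewrite /t; have [->|fne] := eqVneq.
    by rewrite mul1r subrr mul0r mulr0 addr0.
  rewrite mul0r add0r subr0 mul1r mulN1r; apply/eqP.
  by have /eqP := fg s`_i; rewrite eqr_norm2 (negbTE fne).
rewrite fE; have := iter_normD n (t \* (fun i => g s`_i))
  (fun i => -1 * ((fun i => 1 - t i) \* (fun i => g s`_i)) i) 0 0 Gb.
rewrite addr0 => /le_trans; apply; rewrite mulr_natl mulr2n lerD//.
  by apply: null_iter_norm_le => // i; rewrite /t; case: eqP => _; rewrite ?lexx ?ler01.
rewrite [leLHS](_ : _ =
  iter_norm G (mkseq ((fun i => 1 - t i) \* (fun i => g s`_i)) n) 0).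
  apply: null_iter_norm_le => // i; rewrite /t; case: eqP => _;
    by rewrite ?subrr ?subr0 ?lexx ?ler01.
rewrite -[RHS]mul1r -[X in X * _](normrN1 R) -iter_normZ// scaler0; congr iter_norm.
by rewrite /mkseq -map_comp.
Qed.

Lemma null_iter_norm_abs s :
  iter_norm G s 0 <= 2 * iter_norm G [seq `|x| | x <- s] 0 /\
  iter_norm G [seq `|x| | x <- s] 0 <= 2 * iter_norm G s 0.
Proof.
have h1 := @sign_le id Num.norm s; have h2 := @sign_le Num.norm id s.
rewrite map_id in h1 h2.
by split; [apply: h1|apply: h2] => x; rewrite normr_id.
Qed.

Lemma null_iter_norm_mono n (f g : nat -> R) :
  (forall i, (i < n)%N -> 0 <= f i <= g i) ->
  iter_norm G (mkseq f n) 0 <= iter_norm G (mkseq g n) 0.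
Proof.
move=> fg; pose t i := if (i < n)%N then f i / g i else 0.
rewrite [X in iter_norm _ X _](_ : _ = mkseq (t \* g) n).
  apply: null_iter_norm_le => // i; rewrite /t; case: ifP => [/fg/andP[f0 fgi]|_].
    have g0 := le_trans f0 fgi; rewrite divr_ge0//=.
    have [->|gn] := eqVneq (g i) 0; first by rewrite invr0 mulr0 ler01.
    by rewrite ler_pdivrMr ?mul1r// lt_neqAle eq_sym gn.
  by rewrite lexx ler01.
apply/eq_in_map => i; rewrite mem_iota /= /t => ilt; rewrite ilt.
have /andP[f0 fgi] := fg i ilt.
have [g0|gn] := eqVneq (g i) 0; last by rewrite divfK.
by rewrite g0 mulr0; apply/eqP; rewrite eq_le f0 -g0 fgi.
Qed.

End null_lattice.

Section uniform_equivalence.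
Context {R : realType} {X : completeNormedModType R}.

Lemma equivalent_trans (U V W : normedModType R)
    (x : U ^nat) (y : V ^nat) (z : W ^nat) :
  equivalent x y -> equivalent y z -> equivalent x z.
Proof.
have dom_trans (U' V' W' : normedModType R)
    (x' : U' ^nat) (y' : V' ^nat) (z' : W' ^nat) :
    dominates x' y' -> dominates y' z' -> dominates x' z'.
  move=> /dominates_ge0[C C0 xy] /dominates_ge0[D D0 yz].
  exists (D * C); apply/dominates_withP => s.
  by rewrite (le_trans (yz s))// -mulrA ler_wpM2l.
by move=> [xy yx] [yz zy]; split; [exact: dom_trans xy yz|exact: dom_trans zy yx].
Qed.

Lemma equivalentP (V W : normedModType R) (x : V ^nat) (y : W ^nat) (C D : R) :
  (forall s, sum_norm y s <= C * sum_norm x s) ->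
  (forall s, sum_norm x s <= D * sum_norm y s) -> equivalent x y.
Proof. by move=> xy yx; split; [exists C|exists D]; apply/dominates_withP. Qed.

(** When the fundamental function is bounded the norm is at most a multiple of the
    largest coefficient, which is the case of c_0. *)
Lemma uniform_equivalent_lp :
  unique_spreading_model X ->
  (exists D : R, forall (E F : completeNormedModType R) (xt : E ^nat) (yt : F ^nat),
     spreading_model_in X xt -> spreading_model_in X yt -> equivalent_with D xt yt) ->
  exists (p : \bar R) (p1 : (1 <= p)%E),
    forall (E : completeNormedModType R) (xt : E ^nat),
      spreading_model_in X xt -> equivalent xt (unit_vector_basis p1).
Proof.
move=> uX [D DP].
have [l1|allnull] := l1_or_null uX.
  exists 1%E, (lexx _) => E xt smx; have [C C0 CP] := l1 _ _ smx.
  apply: (@equivalentP _ _ _ _ C 1) => s; rewrite sum_norm_l1//.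
  by rewrite mul1r; exact: (spreading_model_le_l1 _ smx).
have [[E0 [x0 smx0]]|noE] := pselect
  (exists (E : completeNormedModType R) (xt : E ^nat), spreading_model_in X xt); last first.
  by exists 1%E, (lexx _) => E xt smx; case: noE; exists E, xt.
suff [p [p1 x0p]] : exists (p : \bar R) (p1 : (1 <= p)%E),
    equivalent x0 (unit_vector_basis p1).
  by exists p, p1 => E xt smx; apply: equivalent_trans (uX _ _ _ _ smx smx0) x0p.
have [G Gx] := spreading_model_ultra smx0; have [G1 GE] := Gx.
have G0 := allnull _ _ _ smx0 Gx; have Gb := generates_nbounded Gx.
pose N (s : seq R) := iter_norm G s 0; pose D' := Num.max D 1.
have D'1 : 1 <= D' by rewrite le_max lexx orbT.
have DD' : D <= D' by rewrite le_max lexx.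
have N0 s : 0 <= N s by exact: iter_norm_ge0 s 0 Gb.
have NGE s : N s = sum_norm x0 s by exact: GE.
have Nentry s i : (i < size s)%N -> `|s`_i| <= N s.
  move=> ilt; rewrite /N -[X in iter_norm _ X _](mkseq_nth 0).
  exact: null_iter_norm_coef.
have N1 : N [:: 1] = 1.
  by rewrite NGE /sum_norm big_ord1 scale1r (spreading_model_normalized smx0).
have Nub s : N s <= \sum_(x <- s) `|x|
  by rewrite NGE; exact: (spreading_model_le_l1 _ smx0).
have NZ c s : N [seq c * x | x <- s] = `|c| * N s.
  by rewrite /N -iter_normZ// scaler0.
have ND n (f g : nat -> R) : N (mkseq (f \+ g) n) <= N (mkseq f n) + N (mkseq g n).
  by rewrite /N -{1}[0]addr0; exact: iter_normD.
have Nfilter s : N [seq x <- s | x != 0] = N s by rewrite /N iter_norm_filter.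
have Nle n (f g : nat -> R) : (forall i, (i < n)%N -> 0 <= f i <= g i) ->
    N (mkseq f n) <= N (mkseq g n) by exact: null_iter_norm_mono.
have Ntensor s t : 0 < N t ->
    N [seq x * y | x <- s, y <- t] <= D' * (N s * N t) /\
    N s * N t <= D' * N [seq x * y | x <- s, y <- t].
  rewrite !NGE => t0; have [F [yt [smy yE]]] :=
    block_spreading_model Gx (null_block t Gb G0) t0.
  have [/dominates_withP xy /dominates_withP yx] := DP _ _ _ _ smx0 smy.
  split.
    rewrite mulrA -ler_pdivrMr// -yE (le_trans (xy s))// ler_wpM2r//.
    exact: sum_norm_ge0.
  rewrite -ler_pdivlMr// -mulrA -yE (le_trans (yx s))// ler_wpM2r//.
  exact: sum_norm_ge0.
pose abs_pos (s : seq R) := [seq x <- [seq `|x| | x <- s] | x != 0].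
have abs_pos_gt0 s x : x \in abs_pos s -> 0 < x.
  by rewrite mem_filter => /andP[xn /mapP[y _ xE]]; rewrite lt_neqAle eq_sym xn xE /=.
have NA s : N s <= 2 * N (abs_pos s).
  by rewrite Nfilter; have [] := null_iter_norm_abs Gb G0 s.
have AN s : N (abs_pos s) <= 2 * N s.
  by rewrite Nfilter; have [] := null_iter_norm_abs Gb G0 s.
have [[K KP]|[a a01 aP]] := tensor_norm_lp N1 Nub NZ ND Nle Nfilter D'1 Ntensor.
  have p1 : (1 <= +oo :> \bar R)%E by rewrite leey.
  exists +oo%E, p1; apply: (@equivalentP _ _ _ _ 1 (2 * K)) => s.
    rewrite mul1r -NGE /sum_norm ellp_norm_ooE.
    by apply/bigmax_leP; split=> // i _; exact: Nentry.
  rewrite -NGE [sum_norm (unit_vector_basis p1) s]ellp_norm_ooE.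
  set M := \big[_/_]_(_ < _) _.
  have M0 : 0 <= M by exact: bigmax_ge_id.
  have [h _] := null_iter_norm_abs Gb G0 s; rewrite (le_trans h)// -mulrA.
  rewrite ler_wpM2l// mulrC (le_trans _ (ler_wpM2l M0 (KP (size s))))//.
  rewrite -[X in X * _]ger0_norm// -NZ map_nseq mulr1.
  have -> : [seq `|x| | x <- s] = mkseq (fun i => `|s`_i|) (size s).
    by rewrite -{1}[s](mkseq_nth 0) /mkseq -map_comp.
  have -> : nseq (size s) M = mkseq (fun=> M) (size s).
    by elim: (size s) => // n IH; rewrite mkseq_cons /= IH.
  apply: Nle => i ilt; rewrite normr_ge0 /=.
  exact: (le_bigmax _ (fun i : 'I_(size s) => `|s`_i|) (Ordinal ilt)).
have /andP[a0 a1] := a01.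
have p1 : (1 <= (a^-1)%:E)%E by rewrite lee_fin invf_ge1.
exists (a^-1)%:E, p1.
have lpE s : sum_norm (unit_vector_basis p1) s =
    (\sum_(x <- abs_pos s) x `^ a^-1) `^ a.
  rewrite sum_norm_lp invrK; congr (_ `^ a).
  rewrite /abs_pos big_filter big_map [RHS]big_mkcond; apply: eq_bigr => x _.
  by case: eqP => // ->; rewrite powR0// invr_eq0 gt_eqF.
apply: (@equivalentP _ _ _ _ (D' * 2) (2 * D')) => s; rewrite -NGE lpE.
  have [_ h] := aP _ (abs_pos_gt0 s).
  by rewrite (le_trans h)// -mulrA ler_wpM2l// (le_trans ler01).
have [h _] := aP _ (abs_pos_gt0 s).
by rewrite (le_trans (NA s))// -mulrA ler_wpM2l.
Qed.

End uniform_equivalence.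

Theorem proposition4p2 (R : realType) (X : completeNormedModType R)
  (infX : infinite_dimensional X)
  (all_equiv : forall (E F : completeNormedModType R) (xt : E ^nat) (yt : F ^nat),
     spreading_model_in X xt -> spreading_model_in X yt -> equivalent xt yt) :
  [/\
    (* (a) *)
    (exists D : R,
       forall (E F : completeNormedModType R) (xt : E ^nat) (yt : F ^nat),
         spreading_model_in X xt -> spreading_model_in X yt ->
         equivalent_with D xt yt) ->
    exists (p : \bar R) (p1 : (1 <= p)%E),
      forall (E : completeNormedModType R) (xt : E ^nat),
        spreading_model_in X xt -> equivalent xt (unit_vector_basis p1),
    (* (b) *)
    forall (Z : completeNormedModType R) (z : Z ^nat),
      normalized_basic z ->
      (exists (E : completeNormedModType R) (xt : E ^nat),
         spreading_model_in X xt /\ dominates z xt) ->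
      exists C : R,
        forall (x : X ^nat) (E : completeNormedModType R) (xt : E ^nat),
          normalized_basic x -> has_spreading_model x xt ->
          dominates_with C z xt,
    (* (c) *)
    forall (x : X ^nat) (E : completeNormedModType R) (xt : E ^nat),
      normalized_basic x -> has_spreading_model x xt ->
      forall (p : \bar R) (p1 : (1 <= p)%E),
        krivine_set xt p -> dominates xt (unit_vector_basis p1) &
    (* (d) *)
    (exists (E : completeNormedModType R) (xt : E ^nat),
       spreading_model_in X xt /\ krivine_set xt 1%E) ->
    forall (E : completeNormedModType R) (xt : E ^nat),
      spreading_model_in X xt ->
      equivalent xt (unit_vector_basis (@lexx _ _ (1%E : \bar R)))].
Proof.
have uX : unique_spreading_model X by exact: all_equiv.
have kriv (E : completeNormedModType R) (xt : E ^nat) (p : \bar R) (p1 : (1 <= p)%E) :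
    spreading_model_in X xt -> krivine_set xt p -> dominates xt (unit_vector_basis p1).
  exact: krivine_dominates.
split.
- exact: uniform_equivalent_lp.
- move=> Z z _ /(spreading_models_uniformly_dominated uX)[C _ CP].
  exists C => x E xt nbx smx; apply/dominates_withP => s.
  by apply: CP; exists x.
- by move=> x E xt nbx smx p p1; apply: kriv; exists x.
- move=> [E0 [x0 [smx0 k1]]] E xt smx.
  apply: equivalent_trans (uX _ _ _ _ smx smx0) _.
  split; first exact: kriv.
  exists 1; apply/dominates_withP => s.
  by rewrite mul1r sum_norm_l1; exact: (spreading_model_le_l1 _ smx0).
Qed.
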